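(* Let $\mathcal{U}$ be a nonempty separable subset of $\mathfrak{C}(\mathbb{E})$, equipped with the induced Pompeiu-Hausdorff metric $h$. Let $\{X_n\}_{n=1}^{+\infty}$ be a sequence of independent identically distributed random sets $X_n:\Omega\to\mathcal{U}$ with expectation $E(X_n)=C$ for every $n\in\mathbb{N}$, where $C\in\mathfrak{C}_c(\mathbb{E})$. Then $$\frac{\overline{\overline{\mathrm{co}}X_1(\omega)+\dots+\overline{\mathrm{co}}X_n(\omega)}}{n}\xrightarrow{h} C\quad\text{as } n\to+\infty,\ \text{a.s. on }\Omega.$$
   Context: $\mathbb{E}$ is an arbitrary (not necessarily separable) real Banach space; $(\Omega,\mathscr{A},P)$ is a complete probability space without atoms. $\mathfrak{C}(\mathbb{E})$ (resp. $\mathfrak{C}_c(\mathbb{E})$) is the space of nonempty closed bounded (resp. nonempty closed convex bounded) subsets of $\mathbb{E}$. For nonempty bounded $X,Y\subset\mathbb{E}$: $d(x,Y)=\inf_{y\in Y}\|x-y\|$, $e(X,Y)=\sup_{x\in X}d(x,Y)$, $h(X,Y)=\max\{e(X,Y),e(Y,X)\}$ (Pompeiu-Hausdorff metric), $\|X\|=\sup_{x\in X}\|x\|$. $\overline{\mathrm{co}}X$ is the closed convex hull. Sums and scalar multiples of sets are elementwise; the bar denotes norm closure. $X_n\xrightarrow{h}X$ means $h(X_n,X)\to0$. Random sets: a map $G:\Omega\to\mathfrak{C}(\mathbb{E})$ is countably-valued if $G(\omega)=\sum_{i=1}^{\infty}A_i\chi_{\Omega_i}(\omega)$ (i.e. $G=A_i$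 on $\Omega_i$) for some $A_i\in\mathfrak{C}(\mathbb{E})$ and some measurable partition $\{\Omega_i\}_{i=1}^\infty$ of $\Omega$. A map $F:\Omega\to\mathfrak{C}(\mathbb{E})$ is strongly measurable if there are countably-valued maps $G_n:\Omega\to\mathfrak{C}(\mathbb{E})$ with $\operatorname{ess\,sup}_{\omega}h(G_n(\omega),F(\omega))\to0$. A random set is a strongly measurable $F:\Omega\to\mathfrak{C}(\mathbb{E})$ with $\int_\Omega\|F(\omega)\|\,dP<+\infty$; a random set $X:\Omega\to\mathcal{U}$ is one with values in $\mathcal{U}$. Independence and identical distribution are in the usual sense for random elements of a metric space (here $(\mathcal{U},h)$). Expectation: a map $f:\Omega\to\mathbb{E}$ is measurable if it is a uniform a.s. limit (in the $\operatorname{ess\,sup}$ norm) of countably-valued maps $\Omega\to\mathbb{E}$; $\mathrm{S}^1_F$ is the set of measurable $f:\Omega\to\mathbb{E}$ with $f(\omega)\in F(\omega)$ for $\omega\in\Omega$. The expectation of a random set $F$ is its Aumann integral $E(F)=\overline{\{\int_\Omega f\,dP : f\in \mathrm{S}^1_F\}}$ (Bochner integrals). *)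

(* Defs.v *)
From HB Require Import structures.
From mathcomp Require Import all_boot all_order all_algebra finmap.
From mathcomp Require Import all_classical all_reals all_analysis ess_sup_inf.

Set Implicit Arguments.
Unset Strict Implicit.
Unset Printing Implicit Defensive.

Import Order.TTheory GRing.Theory Num.Theory.
Import numFieldNormedType.Exports.

Local Open Scope classical_set_scope.
Local Open Scope ring_scope.

Section Hyperspace.
Context {R : realType} {E : completeNormedModType R}.
Implicit Types X Y : set E.

Definition nonempty_closed_bounded : set (set E) :=
  [set X | [/\ X !=set0, closed X & bounded_set X]].

Definition nonempty_closed_convex_bounded : set (set E) :=
  [set X | nonempty_closed_bounded X /\ convex_set X].

(* The quantities below are extended real numbers, hence meaningful for all
   sets; they are finite as soon as the sets are nonempty and bounded. *)
Definition point_set_dist (x : E) Y : \bar R :=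
  ereal_inf [set (`|x - y|)%:E | y in Y].

Definition excess X Y : \bar R :=
  ereal_sup [set point_set_dist x Y | x in X].

Definition hausdorff_dist X Y : \bar R :=
  Order.max (excess X Y) (excess Y X).

Definition set_norm X : \bar R := ereal_sup [set (`|x|)%:E | x in X].

Definition closed_convex_hull X : set E :=
  smallest (fun K : set E => closed K /\ convex_set K) X.

Definition minkowski_sum (n : nat) (A : 'I_n -> set E) : set E :=
  [set \sum_(i < n) x i | x in [set x : 'I_n -> E | forall i, A i (x i)]].

Definition set_scale (c : R) X : set E := [set c *: x | x in X].

Definition hausdorff_separable (U : set (set E)) : Prop :=
  exists D : set (set E), [/\ countable D, D `<=` U &
    forall X (e : R), U X -> 0 < e ->
      exists2 Y, D Y & (hausdorff_dist X Y < e%:E)%E].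

(* Open sets of the metric space (U, hausdorff_dist), seen as subsets of U. *)
Definition hausdorff_open (U : set (set E)) : set (set (set E)) :=
  [set O | O `<=` U /\ forall X, O X -> exists2 e : R, 0 < e &
    forall Y, U Y -> (hausdorff_dist X Y < e%:E)%E -> O Y].

Definition hausdorff_borel (U : set (set E)) : set (set (set E)) :=
  <<s U, hausdorff_open U >>.

End Hyperspace.

Section Atoms.
Context {d : measure_display} {T : measurableType d} {R : realType}.
Variable P : probability T R.

Definition is_atom (A : set T) : Prop :=
  [/\ measurable A, (0 < P A)%E &
      forall B, measurable B -> B `<=` A -> P B = 0%E \/ P B = P A].

Definition without_atoms : Prop := forall A, ~ is_atom A.

End Atoms.

(* Some cells O i of the partition may be empty, so that maps taking finitely
   many values are included. *)
Definition countably_valued {d : measure_display} {T : measurableType d}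
    {V : Type} (D : set V) (g : T -> V) : Prop :=
  exists (a : nat -> V) (O : nat -> set T),
    [/\ (forall i, D (a i)), (forall i, measurable (O i)),
        trivIset setT O, \bigcup_i O i = setT &
        forall i w, O i w -> g w = a i].

Section RandomSets.
Context {d : measure_display} {T : measurableType d} {R : realType}
        {E : completeNormedModType R}.
Variable P : probability T R.

Definition strongly_measurable (F : T -> set E) : Prop :=
  (forall w, nonempty_closed_bounded (F w)) /\
  exists G : nat -> T -> set E,
    (forall n, countably_valued nonempty_closed_bounded (G n)) /\
    ess_sup P (fun w => hausdorff_dist (G n w) (F w)) @[n --> \oo] --> 0%E.

Definition random_set (F : T -> set E) : Prop :=
  strongly_measurable F /\ (\int[P]_w set_norm (F w) < +oo)%E.

Definition measurable_map (f : T -> E) : Prop :=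
  exists g : nat -> T -> E,
    (forall n, countably_valued setT (g n)) /\
    ess_sup P (fun w => (`|g n w - f w|)%:E) @[n --> \oo] --> 0%E.

Definition simple_map (s : T -> E) : Prop :=
  finite_set (range s) /\ forall v, measurable (s @^-1` [set v]).

Definition simple_integral (s : T -> E) : E :=
  \sum_(v \in range s) fine (P (s @^-1` [set v])) *: v.

(* [bochner_integral f I]: f is Bochner integrable, with integral I. *)
Definition bochner_integral (f : T -> E) (I : E) : Prop :=
  exists s : nat -> T -> E,
    [/\ (forall n, simple_map (s n)),
        {ae P, forall w, s n w @[n --> \oo] --> f w},
        (\int[P]_w (`|f w - s n w|)%:E)%E @[n --> \oo] --> 0%E &
        simple_integral (s n) @[n --> \oo] --> I].

Definition measurable_selections (F : T -> set E) : set (T -> E) :=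
  [set f | measurable_map f /\ forall w, F w (f w)].

(* For a random set F every measurable selection f is Bochner integrable,
   since the norm of f w is at most set_norm (F w). *)
Definition aumann_expectation (F : T -> set E) : set E :=
  closure [set I | exists2 f, measurable_selections F f & bochner_integral f I].

Definition independent_random_sets (U : set (set E)) (X : nat -> T -> set E) :
    Prop :=
  forall (J : {fset nat}) (B : nat -> set (set E)),
    (forall j, j \in J -> hausdorff_borel U (B j)) ->
    P (\bigcap_(j in [set` J]) (X j @^-1` B j)) =
    (\prod_(j <- J) P (X j @^-1` B j))%E.

Definition identically_distributed_random_sets (U : set (set E))
    (X : nat -> T -> set E) : Prop :=
  forall m n B, hausdorff_borel U B -> P (X m @^-1` B) = P (X n @^-1` B).

End RandomSets.

(* Main.v *)
From HB Require Import structures.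
Require Import Defs.
From mathcomp Require Import all_boot all_order all_algebra finmap.
From mathcomp Require Import all_classical all_reals all_analysis.
From mathcomp Require Import ess_sup_inf measurable_realfun.
From mathcomp Require Import ring lra.
Import Order.TTheory GRing.Theory Num.Theory.
Import numFieldNormedType.Exports.
Local Open Scope classical_set_scope.
Local Open Scope ring_scope.

Set Implicit Arguments.
Unset Strict Implicit.
Unset Printing Implicit Defensive.

(** Fix e > 0. As U is separable, countably many of its members A 0, A 1, ...
    are e-dense in it, and a Borel partition of U attaches to every X k w an
    index iota k w such that X k w is within e of A (iota k w) ([borel_cells]).
    The indices iota k are pairwise independent and have the law
    p i = P (iota 0 = i). With m large, everything is compared with the finite
    Minkowski sum

      D = p 0 * co (A 0) + ... + p (m - 1) * co (A (m - 1)).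

    The averages are close to D. In the average of the sets co (A (iota k w))
    over k < n, equal indices can be grouped: by convexity, N copies of
    co (A i) add up to N * co (A i). What remains is governed by real numbers
    that do not depend on the chosen points: the deviations of the frequencies
    from the p i, and the part of the average of the norms of the A (iota k w)
    that comes from the indices at least m ([average_sub_weighted_hull_sum],
    [weighted_hull_sum_sub_average]). The strong law makes the frequencies
    converge ([bounded_strong_law]), and bounds the second part, in the limit,
    by twice its mean ([dyadic_strong_law]); this mean is the tail of a
    convergent integral, hence small. The bound is uniform over points, so no
    compactness of the values is needed.

    The expectation C is close to D as well. Let f be a selection of X 0. Its
    Bochner integral is almost the integral of a simple map whose values on
    the event iota 0 = i lie in A i, and such an integral belongs to D up to
    the tail ([selection_integral_near_hulls]). Conversely, given points a i
    of the A i, a selection of X 0 that stays within 4 e of a (iota 0) is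
    built by following almost nearest points through partitions of mesh
    e / 2 ^ n ([exists_selection]); its integral is close to the sum of the
    p i * a i ([weighted_sum_near_expectation]). Hence a closed thickening of C
    contains the sum of the p i * A i; that thickening is closed and convex, as
    C is convex, so each A i can be replaced by its closed convex hull, one
    term at a time ([weighted_hull_sum_thickening]).

    The laws of large numbers come from second moments, so that pairwise
    independence is enough: Chebyshev's inequality and the Borel-Cantelli lemma
    along the squares for bounded variables, and along the powers of 2, with
    truncation at 2 ^ n, for integrable ones; monotonicity of the partial
    sums fills the gaps. *)

(** * Preliminaries on measurability and integrals *)
Section Preliminaries.
Context {d : measure_display} {T : measurableType d} {R : realType}.

Lemma ereal_lt_between (x : \bar R) (e : R) : (x < e%:E)%E ->
  exists2 r : R, (x < r%:E)%E & r < e.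
Proof.
case: x => [x| |]//.
  by rewrite lte_fin => xe; exists ((x + e) / 2); rewrite ?lte_fin midf_lt.
by move=> _; exists (e - 1); rewrite ?ltNyr// gtrBl.
Qed.

Lemma integral_probability_cst (P : probability T R) (c : R) :
  (\int[P]_w c%:E = c%:E)%E.
Proof. by rewrite integral_cst//= [X in (_ * X)%E]probability_setT mule1. Qed.

Lemma measurable_norm_ge (f : T -> R) (c : R) : measurable_fun setT f ->
  measurable [set w | c <= `|f w|].
Proof.
move=> mf; rewrite [X in measurable X](_ : _ = (fun w => `|f w|) @^-1` `[c, +oo[).
  rewrite -[X in measurable X]setTI.
  by apply: (measurableT_comp _ mf) => //; exact: measurable_itv.
by apply/seteqP; split => w; rewrite /= in_itv/= andbT.
Qed.

Lemma measurable_fun_index {I : Type} (kappa : T -> I) (phi : I -> R) :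
  (forall S, measurable (kappa @^-1` S)) ->
  measurable_fun setT (fun w => phi (kappa w)).
Proof. by move=> mkappa _ B mB; rewrite setTI; exact: (mkappa (phi @^-1` B)). Qed.

End Preliminaries.

(** * Independent and identically distributed real variables *)
Section ExpectationProduct.
Context {d : measure_display} {T : measurableType d} {R : realType}.
Context (P : probability T R).
Local Open Scope ereal_scope.

Definition independent (X Y : T -> R) : Prop :=
  forall A B : set R, measurable A -> measurable B ->
    P (X @^-1` A `&` Y @^-1` B) = P (X @^-1` A) * P (Y @^-1` B).

Definition same_law (X Y : T -> R) : Prop :=
  forall A : set R, measurable A -> P (X @^-1` A) = P (Y @^-1` A).

Lemma independent_comp (f g : R -> R) (X Y : T -> R) :
  measurable_fun setT f -> measurable_fun setT g ->
  independent X Y -> independent (f \o X) (g \o Y).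
Proof.
move=> mf mg XY A B mA mB; apply: (XY (f @^-1` A) (g @^-1` B)).
- by rewrite -[f @^-1` A]setTI; exact: mf.
- by rewrite -[g @^-1` B]setTI; exact: mg.
Qed.

Lemma same_law_expectation (X Y : T -> R) (f : R -> R) :
  measurable_fun setT X -> measurable_fun setT Y -> measurable_fun setT f ->
  (forall r, (0 <= f r)%R) -> same_law X Y ->
  \int[P]_w (f (X w))%:E = \int[P]_w (f (Y w))%:E.
Proof.
move=> mX mY mf f0 XY.
pose X' : {mfun T >-> R} := HB.pack X (isMeasurableFun.Build _ _ _ _ _ mX).
pose Y' : {mfun T >-> R} := HB.pack Y (isMeasurableFun.Build _ _ _ _ _ mY).
have mEf : measurable_fun setT (fun r : R => (f r)%:E) by exact/measurable_EFinP.
have fE0 (r : R) : 0 <= (f r)%:E by rewrite lee_fin.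
rewrite -(@ge0_integral_distribution _ _ _ _ _ P X' _ mEf fE0).
rewrite -(@ge0_integral_distribution _ _ _ _ _ P Y' _ mEf fE0).
by apply: eq_measure_integral => A mA _; exact: XY.
Qed.

(** Independence says that the joint law of X and Y is the product of their
    laws, because a product measure is determined by its values on rectangles;
    the factorisation is then Tonelli's theorem. *)
Lemma independent_expectationM (X Y : T -> R) :
  measurable_fun setT X -> measurable_fun setT Y ->
  (forall w, (0 <= X w)%R) -> (forall w, (0 <= Y w)%R) -> independent X Y ->
  \int[P]_w (X w * Y w)%:E = \int[P]_w (X w)%:E * \int[P]_w (Y w)%:E.
Proof.
move=> mX mY X0 Y0 XY.
pose X' : {mfun T >-> R} := HB.pack X (isMeasurableFun.Build _ _ _ _ _ mX).
pose Y' : {mfun T >-> R} := HB.pack Y (isMeasurableFun.Build _ _ _ _ _ mY).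
pose XY2 w := (X w, Y w).
have mXY2 : measurable_fun setT XY2 by exact: measurable_fun_pair.
pose Z' : {mfun T >-> (R * R)%type} := HB.pack XY2 (isMeasurableFun.Build _ _ _ _ _ mXY2).
have joint A : measurable A ->
    (distribution P X' \x distribution P Y') A = distribution P Z' A.
  apply: product_measure_unique => B C mB mC.
  by rewrite /distribution /pushforward -XY.
(* The norms make the integrand nonnegative on the whole plane. *)
pose f (z : (R * R)%type) := (`|z.1| * `|z.2|)%:E.
have mf : measurable_fun setT f.
  by apply/measurable_EFinP/measurable_funM; apply: measurableT_comp => //.
have f0 z : 0 <= f z by rewrite lee_fin mulr_ge0.
have mN : measurable_fun setT (fun r : R => `|r|%:E).
  by apply/measurable_EFinP.
have N0 (r : R) : 0 <= `|r|%:E by rewrite lee_fin.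
transitivity (\int[P]_w (f (XY2 w))).
  by apply: eq_integral => w _; rewrite /f /= !ger0_norm.
rewrite -(@ge0_integral_distribution _ _ _ _ _ P Z' _ mf f0).
transitivity (\int[distribution P X' \x distribution P Y']_z f z).
  by apply: eq_measure_integral => A mA _; exact/esym/joint.
rewrite fubini_tonelli1// /fubini_F /f.
transitivity (\int[distribution P X']_x (`|x|%:E * \int[P]_w (Y w)%:E)).
  apply: eq_integral => x _; rewrite /=.
  under eq_integral do rewrite EFinM.
  rewrite ge0_integralZl//.
  rewrite (@ge0_integral_distribution _ _ _ _ _ P Y' _ mN N0).
  by congr (_ * _); apply: eq_integral => w _ /=; rewrite ger0_norm.
rewrite ge0_integralZr//; last by apply: integral_ge0 => w _; rewrite lee_fin.
rewrite (@ge0_integral_distribution _ _ _ _ _ P X' _ mN N0).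
by congr (_ * _); apply: eq_integral => w _ /=; rewrite ger0_norm.
Qed.
End ExpectationProduct.

(** * The weak law and the Borel-Cantelli lemma *)
Section LargeNumbers.
Context {d : measure_display} {T : measurableType d} {R : realType}.
Context (P : probability T R).

Lemma chebyshev_sqr (f : T -> R) (c : R) : measurable_fun setT f -> 0 < c ->
  (P [set w | (c <= `|f w|)%R] <= (c ^- 2)%:E * \int[P]_w (f w ^+ 2)%:E)%E.
Proof.
move=> mf c0.
set A := [set w | (c <= `|f w|)%R].
have mA : measurable A by exact: measurable_norm_ge.
rewrite -ge0_integralZl//; [|by apply/measurable_EFinP/measurable_funX| | ]; last 2 first.
- by move=> w _; rewrite lee_fin sqr_ge0.
- by rewrite lee_fin invr_ge0 sqr_ge0.
have -> : P A = (\int[P]_w (\1_A w)%:E)%E by rewrite integral_indic// setIT.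
apply: ge0_le_integral => //.
- by apply/measurable_EFinP.
- by apply/measurable_EFinP/measurable_funM => //; apply/measurable_funX.
- move=> w _; rewrite -EFinM lee_fin indicE; case: (boolP (_ \in _)) => [|_].
    rewrite inE /= => cf; rewrite mulrC ler_pdivlMr ?exprn_gt0// mul1r.
    by rewrite -[f w ^+ 2]real_normK ?num_real// ler_sqr ?nnegrE ?(ltW c0).
  by rewrite mulr_ge0// ?invr_ge0 ?sqr_ge0.
Qed.

(** Expanding the square, the mean of (sum Z k) ^ 2 has n diagonal terms of size
    at most v and off-diagonal terms mu ^ 2, so that the variance of the sum is
    at most n * v. All integrands are kept nonnegative by adding
    2 * (n * mu) * sum Z k to (sum Z k - n * mu) ^ 2. *)
Lemma weak_law (Z : nat -> T -> R) (mu v delta : R) (n : nat) :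
  (forall k, measurable_fun setT (Z k)) -> (forall k w, 0 <= Z k w) ->
  0 <= mu -> (forall k, \int[P]_w (Z k w)%:E = mu%:E)%E ->
  (forall k, \int[P]_w (Z k w ^+ 2)%:E <= v%:E)%E ->
  (forall j k, j != k -> \int[P]_w (Z j w * Z k w)%:E = (mu ^+ 2)%:E)%E ->
  (0 < n)%N -> 0 < delta ->
  (P [set w | (n%:R * delta <= `|\sum_(k < n) Z k w - n%:R * mu|)%R]
     <= (v / (n%:R * delta ^+ 2))%:E)%E.
Proof.
move=> mZ Z0 mu0 EZ EZ2 EZZ n0 delta0.
pose S w := \sum_(k < n) Z k w.
have mS : measurable_fun setT S by apply: measurable_sum => k.
have S0 w : 0 <= S w by apply: sumr_ge0.
have v0 : 0 <= v.
  rewrite -lee_fin (le_trans _ (EZ2 0%N))//; apply: integral_ge0 => w _.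
  by rewrite lee_fin sqr_ge0.
have ES : (\int[P]_w (S w)%:E = (n%:R * mu)%:E)%E.
  under eq_integral do rewrite /S -sumEFin.
  rewrite ge0_integral_sum//=; last 2 first.
  - by move=> k; apply/measurable_EFinP.
  - by move=> k w _; rewrite lee_fin.
  under eq_bigr do rewrite EZ.
  by rewrite sumEFin sumr_const card_ord mulr_natl.
have ES2 : (\int[P]_w (S w ^+ 2)%:E <= ((n%:R * mu) ^+ 2 + n%:R * v)%:E)%E.
  have -> : (\int[P]_w (S w ^+ 2)%:E = \sum_(j < n) \sum_(k < n) \int[P]_w (Z j w * Z k w)%:E)%E.
    transitivity (\int[P]_w (\sum_(j < n) \sum_(k < n) (Z j w * Z k w)%:E))%E.
      apply: eq_integral => w _; under eq_bigr do rewrite sumEFin.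
      rewrite sumEFin; congr EFin; rewrite expr2 mulr_suml.
      by apply: eq_bigr => j _; rewrite mulr_sumr.
    rewrite ge0_integral_sum//=; last 2 first.
    - move=> j; apply: emeasurable_sum => k; apply/measurable_EFinP.
      exact: measurable_funM.
    - by move=> j w _; apply: sume_ge0 => k _; rewrite lee_fin mulr_ge0.
    apply: eq_bigr => j _; rewrite ge0_integral_sum//=.
    - by move=> k; apply/measurable_EFinP/measurable_funM.
    - by move=> k w _; rewrite lee_fin mulr_ge0.
  apply: (@le_trans _ _ (\sum_(j < n) \sum_(k < n) (mu ^+ 2 + (j == k)%:R * v)%:E)%E).
    apply: lee_sum => j _; apply: lee_sum => k _.
    have [<-|jk] := eqVneq j k; last by rewrite EZZ// mul0r addr0.
    under eq_integral do rewrite -expr2.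
    by rewrite (le_trans (EZ2 _))// lee_fin mul1r lerDr sqr_ge0.
  under eq_bigr do rewrite sumEFin.
  rewrite sumEFin lee_fin.
  under eq_bigr => j _ do rewrite big_split/= sumr_const card_ord -mulr_suml.
  rewrite big_split/= sumr_const card_ord -mulr_suml exprMn.
  rewrite -[_ *+ n *+ n]mulr_natl -[mu ^+ 2 *+ n]mulr_natl.
  have -> : \sum_(i < n) \sum_(i0 < n) (i == i0)%:R = n%:R :> R.
    under eq_bigr => j _.
      rewrite (bigD1 j)//= eqxx big1 ?addr0; last first.
        by move=> k kj; rewrite eq_sym (negbTE kj).
      over.
    by rewrite sumr_const card_ord.
  by rewrite mulrA -expr2.
have EV : (\int[P]_w ((S w - n%:R * mu) ^+ 2)%:E <= (n%:R * v)%:E)%E.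
  have nm0 : 0 <= n%:R * mu by rewrite mulr_ge0.
  (* The subtraction-free form of: the variance is the mean of the square minus
     the square of the mean. *)
  have : (\int[P]_w ((S w - n%:R * mu) ^+ 2)%:E + (2 * (n%:R * mu) ^+ 2)%:E
      = \int[P]_w (S w ^+ 2)%:E + ((n%:R * mu) ^+ 2)%:E)%E.
    have -> : ((2 * (n%:R * mu) ^+ 2)%:E = \int[P]_w (2 * (n%:R * mu) * S w)%:E)%E.
      under eq_integral do rewrite EFinM.
      rewrite ge0_integralZl//; [|by apply/measurable_EFinP| |]; last 2 first.
      - by move=> w _; rewrite lee_fin.
      - by rewrite lee_fin mulr_ge0.
      by rewrite ES -EFinM; congr EFin; rewrite expr2 !mulrA.
    have -> : (((n%:R * mu) ^+ 2)%:E = \int[P]_w ((n%:R * mu) ^+ 2)%:E)%E.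
      by rewrite integral_probability_cst.
    rewrite -!ge0_integralD//; do 1?[
      by move=> w _; rewrite lee_fin ?sqr_ge0// !mulr_ge0
    | by apply/measurable_EFinP; do ?[exact: measurable_funX
        | exact: measurable_funM | exact/measurable_funX/measurable_funB]].
    by apply: eq_integral => w _; rewrite -!EFinD; congr EFin; ring.
  move=> EE; rewrite -(@leeD2rE _ (2 * (n%:R * mu) ^+ 2)%:E)// EE.
  apply: (le_trans (leeD2r _ ES2)).
  by rewrite -!EFinD lee_fin le_eqVlt; apply/orP; left; apply/eqP; ring.
have nd0 : 0 < n%:R * delta by rewrite mulr_gt0// ltr0n.
apply: (le_trans (chebyshev_sqr (f := fun w => S w - n%:R * mu) _ nd0)).
  exact: measurable_funB.
apply: (le_trans (lee_wpmul2l _ EV)); first by rewrite lee_fin invr_ge0 sqr_ge0.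
rewrite -EFinM lee_fin le_eqVlt; apply/orP; left; apply/eqP; field.
by rewrite gt_eqF//= pnatr_eq0 -lt0n n0.
Qed.

(** The Borel-Cantelli lemma, for a series of probabilities whose partial sums
    are bounded. *)
Lemma ae_eventually_not (F : nat -> set T) (M : R) :
  (forall n, measurable (F n)) ->
  (forall N, \sum_(n < N) P (F n) <= M%:E)%E ->
  {ae P, forall w, \forall n \near \oo, ~ F n w}.
Proof.
move=> mF FM.
have : P (lim_sup_set F) = 0%E.
  apply: lim_sup_set_cvg0 => //; apply: (@le_lt_trans _ _ M%:E); last by rewrite ltry.
  apply: lime_le; first by apply: is_cvg_nneseries => n _ _; exact: measure_ge0.
  by apply: nearW => N; rewrite big_mkord.
move=> P0; exists (lim_sup_set F); split => //.
  apply: bigcap_measurable => // n _; exact: bigcup_measurable.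
move=> w /= nF n _; apply: contrapT => nFn; apply: nF.
by exists n => //= j nj Fj; apply: nFn; exists j.
Qed.

End LargeNumbers.

(** * Strong laws along subsequences *)
Lemma increasing_bracket (q : nat -> nat) (m : nat) :
  (forall n, (q n < q n.+1)%N) -> (q 0 <= m)%N ->
  exists n, (q n <= m < q n.+1)%N.
Proof.
move=> q_incr; elim: m => [|m IH].
  rewrite leqn0 => /eqP q0; exists 0%N.
  by rewrite q0 leqnn/= (leq_ltn_trans _ (q_incr 0%N)).
rewrite leq_eqVlt => /predU1P[q0|]; first by exists 0%N; rewrite -q0 leqnn q_incr.
rewrite ltnS => /IH[n /andP[qm mq]].
have [lt|ge] := ltnP m.+1 (q n.+1); first by exists n; rewrite lt leqW.
by exists n.+1; rewrite ge/= (leq_ltn_trans mq).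
Qed.

Lemma partial_sum_le {R : realType} (x : nat -> R) (m n : nat) :
  (forall k, 0 <= x k) -> (m <= n)%N ->
  \sum_(k < m) x k <= \sum_(k < n) x k.
Proof.
move=> x0 mn; rewrite -!(big_mkord xpredT (fun k => x k)).
by rewrite [leRHS](big_cat_nat (n := m))//= lerDl sumr_ge0.
Qed.

Section StrongLaws.
Context {d : measure_display} {T : measurableType d} {R : realType}.
Context (P : probability T R).
Context (Y : nat -> T -> R).
Context (mY : forall k, measurable_fun setT (Y k)).
Context (Y0 : forall k w, 0 <= Y k w).
Context (Y_indep : forall j k, j != k -> independent P (Y j) (Y k)).
Context (Y_law : forall k, same_law P (Y k) (Y 0%N)).

Lemma ge0_expectation_le (g : T -> R) (K : R) :
  measurable_fun setT g -> (forall w, 0 <= g w <= K) ->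
  ((\int[P]_w (g w)%:E \is a fin_num) /\ (\int[P]_w (g w)%:E <= K%:E))%E.
Proof.
move=> mg gK.
have g0 w : (0 <= (g w)%:E)%E by rewrite lee_fin; case/andP: (gK w).
have le : (\int[P]_w (g w)%:E <= K%:E)%E.
  rewrite -(integral_probability_cst P K).
  apply: ge0_le_integral => //; first exact/measurable_EFinP.
  by move=> w _; rewrite lee_fin; case/andP: (gK w).
split => //; rewrite ge0_fin_numE; last exact: integral_ge0.
by rewrite (le_lt_trans le)// ltry.
Qed.

(** Truncations of the Y k are functions of the Y k, hence still pairwise
    independent with a common law; this is the form of the weak law that both
    strong laws use. *)
Lemma weak_law_comp (f : R -> R) (M delta : R) (n : nat) :
  measurable_fun setT f -> (forall r, 0 <= f r <= M) ->
  (0 < n)%N -> 0 < delta ->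
  (P [set w | (n%:R * delta <= `|\sum_(k < n) f (Y k w) -
       n%:R * fine (\int[P]_w (f (Y 0%N w))%:E)|)%R]
     <= (fine (\int[P]_w (f (Y 0%N w) ^+ 2)%:E) / (n%:R * delta ^+ 2))%:E)%E.
Proof.
move=> mf fM n0 d0.
have f0 r : 0 <= f r by case/andP: (fM r).
have mfY k : measurable_fun setT (fun w => f (Y k w)) by exact: measurableT_comp.
have mfY0 := mfY 0%N.
have Efin : (\int[P]_w (f (Y 0%N w))%:E)%E \is a fin_num.
  by have [] := ge0_expectation_le mfY0 (fun w => fM (Y 0%N w)).
have E2fin : (\int[P]_w (f (Y 0%N w) ^+ 2)%:E)%E \is a fin_num.
  have [|w|//] := @ge0_expectation_le (fun w => f (Y 0%N w) ^+ 2) (M ^+ 2).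
    exact: measurable_funX.
  rewrite sqr_ge0/= ler_sqr ?nnegrE//; first by case/andP: (fM (Y 0%N w)).
  by have /andP[] := fM (Y 0%N w); exact: le_trans.
have EY k : (\int[P]_w (f (Y k w))%:E = \int[P]_w (f (Y 0%N w))%:E)%E.
  exact: same_law_expectation.
have EY2 k : (\int[P]_w (f (Y k w) ^+ 2)%:E = \int[P]_w (f (Y 0%N w) ^+ 2)%:E)%E.
  apply: (@same_law_expectation _ _ _ P _ _ (fun r => f r ^+ 2)) => //.
    exact: measurable_funX.
  by move=> r; exact: sqr_ge0.
apply: (@weak_law _ _ _ P (fun k w => f (Y k w))) => //.
- by rewrite fine_ge0// integral_ge0// => w _; rewrite lee_fin.
- by move=> k; rewrite EY fineK.
- by move=> k; rewrite EY2 fineK.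
- move=> j k jk; rewrite independent_expectationM//.
    by rewrite !EY expr2 EFinM fineK.
  by apply: (independent_comp mf mf); exact: Y_indep.
Qed.

Lemma measurable_deviation (f : R -> R) (n : nat) (mu c : R) :
  measurable_fun setT f ->
  measurable [set w | c <= `|\sum_(k < n) f (Y k w) - mu|].
Proof.
move=> mf.
apply: (measurable_norm_ge (f := fun w => \sum_(k < n) f (Y k w) - mu)).
apply: measurable_funB => //.
by apply: measurable_sum => k; exact: measurableT_comp.
Qed.

(** Telescoping: 1 / (n + 2) ^ 2 is at most 1 / (n + 1) - 1 / (n + 2). *)
Lemma sum_inv_sqr_le2 (N : nat) : \sum_(n < N) (n.+1%:R ^+ 2)^-1 <= 2 :> R.
Proof.
suff H m : \sum_(n < m.+1) (n.+1%:R ^+ 2)^-1 <= 2 - m.+1%:R^-1 :> R.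
  case: N => [|N]; first by rewrite big_ord0.
  by rewrite (le_trans (H N))// gerBl.
elim: m => [|m IH]; first by rewrite big_ord1 expr1n invr1; lra.
rewrite big_ord_recr/= (le_trans (lerD IH (lexx _)))//.
have m0 : 0 < m.+1%:R :> R by rewrite ltr0n.
rewrite -[m.+2]addn1 natrD.
set x : R := m.+1%:R in m0 *.
rewrite -subr_ge0.
have -> : 2 - (x + 1%:R)^-1 - (2 - x^-1 + ((x + 1%:R) ^+ 2)^-1) =
   (x * (x + 1) ^+ 2)^-1.
  by field; rewrite !gt_eqF//; lra.
by rewrite invr_ge0 mulr_ge0 ?sqr_ge0// ltW.
Qed.

(** The deviation probabilities at the times n ^ 2 are of order 1 / n ^ 2, hence
    summable. Between two squares the sum and n * mu each grow by at most the
    length of the gap, which is negligible with respect to the square. *)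
Lemma bounded_strong_law (delta : R) : (forall k w, Y k w <= 1) -> 0 < delta ->
  {ae P, forall w, \forall n \near \oo,
    `|\sum_(k < n) Y k w - n%:R * fine (\int[P]_w (Y 0%N w)%:E)|
      <= n%:R * delta}.
Proof.
move=> Y1 d0; set mu := fine _.
have mu01 : 0 <= mu <= 1.
  have [|w|fin1 le1] := @ge0_expectation_le (Y 0%N) 1; first exact: mY.
    by rewrite Y0 Y1.
  rewrite /mu fine_ge0 ?integral_ge0//=; last by move=> w _; rewrite lee_fin.
  by rewrite -lee_fin fineK.
(* The identity on the values of the Y k, made bounded on the whole line. *)
pose f (r : R) := Num.min `|r| 1.
have fY k w : f (Y k w) = Y k w by rewrite /f ger0_norm// min_l.
have mf : measurable_fun setT f by apply: measurable_minr => //.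
have f01 r : 0 <= f r <= 1 by rewrite /f ge_min lexx orbT le_min normr_ge0 ler01.
have efY : (\int[P]_w (f (Y 0%N w))%:E = \int[P]_w (Y 0%N w)%:E)%E.
  by apply: eq_integral => w _; rewrite fY.
pose q n := (n.+1 ^ 2)%N.
pose e := delta / 4.
have e0 : 0 < e by rewrite divr_gt0.
pose F n := [set w | (q n)%:R * e <= `|\sum_(k < q n) f (Y k w) - (q n)%:R * mu|].
have PF n : (P (F n) <= ((e ^+ 2)^-1 * ((n.+1)%:R ^+ 2)^-1)%:E)%E.
  have qn0 : (0 < q n)%N by rewrite expn_gt0.
  have := weak_law_comp mf f01 qn0 e0; rewrite efY -/mu => /le_trans; apply.
  rewrite lee_fin invfM [X in _ <= X]mulrC /q natrX ler_piMl//.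
    by rewrite mulr_ge0// invr_ge0 ?sqr_ge0.
  have [|w|fin1 le1] := @ge0_expectation_le (fun w => f (Y 0%N w) ^+ 2) 1.
  - by apply: measurable_funX; exact: measurableT_comp.
  - by rewrite sqr_ge0/= expr_le1//; case/andP: (f01 (Y 0%N w)).
  - by rewrite -lee_fin fineK.
have mF n : measurable (F n) by exact: measurable_deviation.
have SF N : (\sum_(n < N) P (F n) <= ((e ^+ 2)^-1 * 2)%:E)%E.
  apply: (@le_trans _ _ (\sum_(n < N) ((e ^+ 2)^-1 * (n.+1%:R ^+ 2)^-1)%:E)%E).
    by apply: lee_sum => n _; exact: PF.
  rewrite sumEFin lee_fin -mulr_sumr ler_wpM2l//.
    by rewrite invr_ge0 sqr_ge0.
  exact: sum_inv_sqr_le2.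
apply: filterS (ae_eventually_not mF SF) => w [n0 _ nF].
have nF' n : (n0 <= n)%N -> `|\sum_(k < q n) Y k w - (q n)%:R * mu| < (q n)%:R * e.
  move=> /nF /negP; rewrite /F /= -real_ltNge ?num_real//.
  by under eq_bigr do rewrite fY.
(* From n1 on, n.+1 * e is at least 1, so that the gap 2 n + 3 between
   consecutive squares is at most 3 * e * n.+1 ^ 2. *)
pose n1 := maxn n0 (Num.truncn e^-1).+1.
exists (q n1) => // m /= n1m.
have [n /andP[qm mq]] : exists n, (q n <= m < q n.+1)%N.
  apply: increasing_bracket => [n|]; first by rewrite /q ltn_exp2r.
  by rewrite (leq_trans _ n1m)// /q leq_exp2r.
have n1n : (n1 <= n)%N.
  by have := leq_ltn_trans n1m mq; rewrite /q ltn_exp2r// ltnS.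
have Sq := nF' _ (leq_trans (leq_maxl _ _) n1n).
have Sqm : \sum_(k < q n) Y k w <= \sum_(k < m) Y k w.
  exact: (@partial_sum_le R (fun k => Y k w)).
have Smq : \sum_(k < m) (1 - Y k w) >= \sum_(k < q n) (1 - Y k w).
  by apply: (@partial_sum_le R (fun k => 1 - Y k w)) => // k; rewrite subr_ge0.
rewrite !sumrB !sumr_const !card_ord in Smq.
have en : 1 <= n.+1%:R * e.
  rewrite -ler_pdivrMr// mul1r ltW// (lt_le_trans (truncnS_gt _))// ler_nat.
  by apply: leqW; apply: leq_trans n1n; exact: leq_maxr.
have qE : (q n)%:R = n.+1%:R ^+ 2 :> R by rewrite /q natrX.
have mR : m%:R <= n.+2%:R ^+ 2 :> R by rewrite -natrX ler_nat ltnW.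
have qmR : (q n)%:R <= m%:R :> R by rewrite ler_nat.
have SnR : n.+2%:R = n.+1%:R + 1 :> R by rewrite -addn1 natrD.
have n1R : 1 <= n.+1%:R :> R by rewrite ler1n.
rewrite SnR in mR.
have de : delta = 4 * e by rewrite /e; field.
move: Sq; rewrite ltr_norml => /andP[Sq1 Sq2].
case/andP: mu01 => mu0 mu1.
have ne : n.+1%:R <= (q n)%:R * e.
  by rewrite qE expr2 -mulrA ler_peMr// ltW// ltr0n.
have mq3 : m%:R - (q n)%:R <= 3 * (q n)%:R * e.
  rewrite -mulrA (le_trans _ (ler_wpM2l _ ne))// qE; nra.
have mue : 0 <= (m%:R - (q n)%:R) * mu <= m%:R - (q n)%:R.
  by rewrite mulr_ge0 ?subr_ge0//= ler_piMr// subr_ge0.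
have qme : (q n)%:R * e <= m%:R * e by rewrite ler_pM2r.
rewrite de ler_norml; apply/andP; split; lra.
Qed.

(** The terms with 2 ^ n below y and those with 2 ^ n above y each form a
    geometric series of sum at most 2 y. *)
Lemma sum_truncated_sqr (y : R) (N : nat) : 0 <= y ->
  \sum_(n < N) Num.min y (2 ^+ n) ^+ 2 / 2 ^+ n <= 4 * y.
Proof.
move=> y0.
(* The first bound records the part of the second series that is still to come
   after N; the second one bounds the first series. *)
have [H1 H2] : (y <= 2 ^+ N -> \sum_(n < N) Num.min y (2 ^+ n) ^+ 2 / 2 ^+ n <=
    4 * y - 2 * y ^+ 2 / 2 ^+ N) /\ (2 ^+ N <= y ->
    \sum_(n < N) Num.min y (2 ^+ n) ^+ 2 / 2 ^+ n <= 2 ^+ N).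
  elim: N => [|N [IH1 IH2]].
    by rewrite big_ord0 expr0 divr1; split => ?; [nra|].
  rewrite big_ord_recr/= exprS.
  have := IH1; have := IH2; move: (\sum_(i < N) _) => S {}IH2 {}IH1.
  have p0 : 0 < 2 ^+ N :> R by rewrite exprn_gt0.
  move: (2 ^+ N) p0 IH1 IH2 => p p0 IH1 IH2.
  have [yp|py] := leP y p.
    have {}IH1 := IH1 yp; split => h.
      have -> : 2 * y ^+ 2 / (2 * p) = y ^+ 2 / p by field; rewrite gt_eqF.
      by move: IH1; rewrite -mulrA; lra.
    have : p = 0 by lra.
    by move=> p00; rewrite p00 ltxx in p0.
  have {}IH2 := IH2 (ltW py).
  have pp : p ^+ 2 / p = p by field; rewrite gt_eqF.
  rewrite pp; split => h; last lra.
  have -> : 2 * y ^+ 2 / (2 * p) = y ^+ 2 / p by field; rewrite gt_eqF.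
  rewrite (le_trans (lerD IH2 (lexx _)))// -subr_ge0.
  have -> : 4 * y - y ^+ 2 / p - (p + p) = (4 * y * p - y ^+ 2 - 2 * p ^+ 2) / p.
    by field; rewrite gt_eqF.
  by rewrite divr_ge0 ?ltW//; nra.
have [yN|Ny] := leP y (2 ^+ N).
  rewrite (le_trans (H1 yN))// gerBl.
  by rewrite divr_ge0// ?exprn_ge0// mulr_ge0// sqr_ge0.
by rewrite (le_trans (H2 (ltW Ny)))//; lra.
Qed.

(** At time 2 ^ n the variables are truncated at 2 ^ n. The probability that the
    truncation changes one of the first 2 ^ n variables, and that of a
    deviation of the truncated sum, are both bounded by the mean of
    min (Y 0) (2 ^ n) ^ 2 / 2 ^ n, up to a factor depending on delta, and these
    means are summable by [sum_truncated_sqr]. The factor 2 in the conclusion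
    is lost by comparing any n with the next power of 2. *)
Lemma dyadic_strong_law (mu delta : R) :
  (\int[P]_w (Y 0%N w)%:E = mu%:E)%E -> 0 < delta ->
  {ae P, forall w, \forall n \near \oo,
    \sum_(k < n) Y k w <= 2 * n%:R * (mu + delta)}.
Proof.
move=> EY d0.
pose f (p r : R) := Num.min `|r| p.
have fY p k w : f p (Y k w) = Num.min (Y k w) p by rewrite /f ger0_norm.
have mf p : measurable_fun setT (f p) by apply: measurable_minr => //.
have mfY p k : measurable_fun setT (fun w => f p (Y k w)) by exact: measurableT_comp.
pose mu_ n := fine (\int[P]_w (f (2 ^+ n) (Y 0%N w))%:E)%E.
pose v_ n := fine (\int[P]_w (f (2 ^+ n) (Y 0%N w) ^+ 2)%:E)%E.
have p0 n : 0 < 2 ^+ n :> R by rewrite exprn_gt0.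
have f01 n r : 0 <= f (2 ^+ n) r <= 2 ^+ n.
  by rewrite /f ge_min lexx orbT le_min normr_ge0 ltW.
have mu0 : 0 <= mu.
  by rewrite -lee_fin -EY integral_ge0// => w _; rewrite lee_fin.
have mu_le n : mu_ n <= mu.
  have [|w|fin1 _] := @ge0_expectation_le (fun w => f (2 ^+ n) (Y 0%N w)) (2 ^+ n).
  - exact: mfY.
  - exact: f01.
  rewrite -lee_fin fineK// -EY; apply: ge0_le_integral => //.
  - by move=> w _; rewrite lee_fin; case/andP: (f01 n (Y 0%N w)).
  - exact/measurable_EFinP.
  - exact/measurable_EFinP.
  - by move=> w _; rewrite lee_fin fY ge_min lexx.
have v_fin n : (\int[P]_w (f (2 ^+ n) (Y 0%N w) ^+ 2)%:E)%E \is a fin_num.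
  have [|w|//] := @ge0_expectation_le (fun w => f (2 ^+ n) (Y 0%N w) ^+ 2) ((2 ^+ n) ^+ 2).
  - exact: measurable_funX.
  - rewrite sqr_ge0/=; case/andP: (f01 n (Y 0%N w)) => a b.
    by rewrite ler_sqr ?nnegrE// ltW.
(* A n k : truncation matters for Y k; B n : the truncated sum deviates. *)
pose A n k := [set w | 2 ^+ n <= `|Y k w|].
pose B n := [set w | (2 ^ n)%:R * delta <=
  `|\sum_(k < 2 ^ n) f (2 ^+ n) (Y k w) - (2 ^ n)%:R * mu_ n|].
have mA n k : measurable (A n k) by exact: measurable_norm_ge.
have mB n : measurable (B n) by exact: measurable_deviation.
pose F n := (\big[setU/set0]_(k < 2 ^ n) A n k) `|` B n.
have mF n : measurable (F n).
  by apply: measurableU => //; exact: bigsetU_measurable.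
have PA n k : (P (A n k) <= (v_ n / (2 ^+ n) ^+ 2)%:E)%E.
  have AfY : A n k = [set w | (2 ^+ n <= `|f (2 ^+ n) (Y k w)|)%R].
    apply/seteqP; split => w; rewrite /A /= fY !ger0_norm//; last 3 first.
    - by rewrite le_min Y0 ltW.
    - by rewrite le_min => /andP[].
    - by rewrite le_min Y0 ltW.
    by rewrite le_min lexx andbT.
  rewrite AfY; apply: (le_trans (chebyshev_sqr _ (mfY (2 ^+ n) k) (p0 n))).
  rewrite mulrC EFinM fineK//; apply: lee_wpmul2l; first by rewrite lee_fin invr_ge0 sqr_ge0.
  rewrite (@same_law_expectation _ _ _ P (Y k) (Y 0%N) (fun r => f (2 ^+ n) r ^+ 2))//.
    exact: measurable_funX.
  by move=> r; exact: sqr_ge0.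
have PB n : (P (B n) <= (v_ n / (2 ^+ n * delta ^+ 2))%:E)%E.
  rewrite -natrX; apply: (@weak_law_comp (f (2 ^+ n)) (2 ^+ n)) => //.
  by rewrite expn_gt0.
have PF n : (P (F n) <= ((1 + (delta ^+ 2)^-1) * (v_ n / 2 ^+ n))%:E)%E.
  apply: (le_trans (measureU2 _ _ _)) => //; first exact: bigsetU_measurable.
  rewrite mulrDl mul1r EFinD; apply: leeD.
    apply: (@le_trans _ _ (\sum_(k < 2 ^ n) P (A n k))%E).
      exact: Boole_inequality.
    apply: (@le_trans _ _ (\sum_(k < 2 ^ n) (v_ n / (2 ^+ n) ^+ 2)%:E)%E).
      by apply: lee_sum => k _; exact: PA.
    rewrite sumEFin sumr_const card_ord lee_fin -[_ *+ _]mulr_natr natrX.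
    by rewrite le_eqVlt; apply/orP; left; apply/eqP; field; rewrite gt_eqF.
  apply: (le_trans (PB n)); rewrite lee_fin le_eqVlt; apply/orP; left; apply/eqP.
  by rewrite invfM mulrA mulrC.
have SF N : (\sum_(n < N) P (F n) <= ((1 + (delta ^+ 2)^-1) * (4 * mu))%:E)%E.
  apply: (@le_trans _ _ (\sum_(n < N) ((1 + (delta ^+ 2)^-1) * (v_ n / 2 ^+ n))%:E)%E).
    by apply: lee_sum => n _; exact: PF.
  rewrite sumEFin lee_fin -mulr_sumr ler_wpM2l ?addr_ge0 ?invr_ge0 ?sqr_ge0//.
  rewrite -lee_fin -sumEFin.
  have -> : (\sum_(n < N) (v_ n / 2 ^+ n)%:E =
      \sum_(n < N) \int[P]_w ((2 ^+ n)^-1 * f (2 ^+ n) (Y 0%N w) ^+ 2)%:E)%E.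
    apply: eq_bigr => n _; under eq_integral do rewrite EFinM.
    rewrite ge0_integralZl//.
    - by rewrite mulrC EFinM /v_ fineK.
    - exact/measurable_EFinP/measurable_funX.
    - by move=> w _; rewrite lee_fin sqr_ge0.
  rewrite -ge0_integral_sum//=; last 2 first.
  - by move=> n; apply/measurable_EFinP/measurable_funM => //; exact: measurable_funX.
  - by move=> n w _; rewrite lee_fin mulr_ge0 ?sqr_ge0// invr_ge0 ltW.
  rewrite EFinM -EY -ge0_integralZl//; last 2 first.
  - exact/measurable_EFinP.
  - by move=> w _; rewrite lee_fin.
  apply: ge0_le_integral => //.
  - move=> w _; apply: sume_ge0 => n _.
    by rewrite lee_fin mulr_ge0 ?sqr_ge0// invr_ge0 ltW.
  - apply: emeasurable_sum => n; apply/measurable_EFinP/measurable_funM => //.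
    exact: measurable_funX.
  - by apply/measurable_EFinP/measurable_funM.
  - move=> w _; rewrite sumEFin -EFinM lee_fin.
    apply: le_trans (sum_truncated_sqr N (Y0 0%N w)).
    by apply: ler_sum => n _; rewrite fY mulrC.
apply: filterS (ae_eventually_not mF SF) => w [n0 _ nF].
exists (2 ^ n0)%N => // m /= n0m.
have [n /andP[qm mq]] : exists n, (2 ^ n <= m < 2 ^ n.+1)%N.
  apply: increasing_bracket => [n|]; first by rewrite ltn_exp2l.
  by rewrite (leq_trans _ n0m)// expn_gt0.
have n0n : (n0 <= n.+1)%N.
  by have := leq_ltn_trans n0m mq; rewrite ltn_exp2l// => /ltnW.
have := nF _ n0n; rewrite /F /= => /not_orP[nA nB].
have {}nB : \sum_(k < 2 ^ n.+1) f (2 ^+ n.+1) (Y k w) <= (2 ^ n.+1)%:R * (mu + delta).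
  move: nB => /negP; rewrite /B /= -real_ltNge ?num_real// ltr_norml => /andP[_].
  rewrite ltrBlDr => /ltW /le_trans; apply.
  by rewrite mulrDr addrC lerD2r ler_wpM2l.
rewrite (le_trans (partial_sum_le (fun k => Y0 k w) (ltnW mq)))//.
have -> : \sum_(k < 2 ^ n.+1) Y k w = \sum_(k < 2 ^ n.+1) f (2 ^+ n.+1) (Y k w).
  apply: eq_bigr => k _; rewrite fY min_l// leNgt; apply/negP => lt; apply: nA.
  by rewrite -bigcup_mkord; exists k => //=; rewrite /A/= ger0_norm// ltW.
rewrite (le_trans nB)// ler_pM2r ?ltr_wpDl//.
by rewrite -natrM ler_nat expnS leq_mul2l qm orbT.
Qed.

End StrongLaws.

(** * Closed thickenings and closed convex hulls *)
Section Thickening.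
Context {R : realType} {E : completeNormedModType R}.
Implicit Types (X Y K : set E) (x y : E) (e : R).

Lemma convex_setP K : convex_set K <->
  (forall x y (t : R), 0 <= t <= 1 -> K x -> K y -> K (t *: x + (1 - t) *: y)).
Proof.
split=> [cK x y t /andP[t0 t1] Kx Ky|cK x y t].
  by have := cK x y (Itv01 t0 t1); rewrite !inE; apply.
rewrite !inE => Kx Ky; apply: (cK x y t%:num) => //.
by rewrite ge0/= le1.
Qed.

Lemma closureP K x :
  closure K x <-> (forall e, 0 < e -> exists2 y, K y & `|x - y| <= e).
Proof.
split=> [Kx e e0|H B].
  have /Kx[y [Ky]] := nbhsx_ballx x e e0.
  by rewrite -ball_normE /= => xy; exists y => //; exact: ltW.
rewrite -nbhs_ballE => -[e/= e0 eB].
have [|y Ky xy] := H (e / 2); first by rewrite divr_gt0.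
exists y; split => //; apply: eB; rewrite -ball_normE /=.
by rewrite (le_lt_trans xy)// ltr_pdivrMr// ltr_pMr// ltr1n.
Qed.

(** The points at distance at most e from K. Asking for every eta > 0 makes this
    set closed even when no point of K is nearest. *)
Definition thickening e K : set E :=
  [set x | forall eta, 0 < eta -> exists2 y, K y & `|x - y| <= e + eta].

Lemma thickening_triangle e e' X Y K :
  X `<=` thickening e Y -> Y `<=` thickening e' K -> X `<=` thickening (e + e') K.
Proof.
move=> XY YK x /XY Yx eta eta0; have eta20 : 0 < eta / 2 by rewrite divr_gt0.
have [y /YK Ky xy] := Yx _ eta20; have [z Kz yz] := Ky _ eta20.
exists z => //; rewrite (le_trans (ler_distD y _ _))//.
by rewrite (le_trans (lerD xy yz))// addrACA -splitr.
Qed.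

Lemma thickening_le e e' K : e <= e' -> thickening e K `<=` thickening e' K.
Proof.
move=> ee' x Kx eta /Kx[y Ky xy]; exists y => //.
by rewrite (le_trans xy)// lerD2r.
Qed.

Lemma closed_thickening e K : closed (thickening e K).
Proof.
move=> x /closureP Kx eta eta0; have eta20 : 0 < eta / 2 by rewrite divr_gt0.
have [y /(_ _ eta20)[z Kz yz] xy] := Kx _ eta20.
exists z => //; rewrite (le_trans (ler_distD y _ _))//.
by rewrite (le_trans (lerD xy yz))// addrCA -splitr.
Qed.

Lemma convex_thickening e K : convex_set K -> convex_set (thickening e K).
Proof.
move=> /convex_setP cK; apply/convex_setP => x y t /andP[t0 t1] Kx Ky eta eta0.
have [x' Kx' xx'] := Kx _ eta0; have [y' Ky' yy'] := Ky _ eta0.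
exists (t *: x' + (1 - t) *: y'); first by apply: cK => //; rewrite t0.
rewrite opprD addrACA -!scalerBr (le_trans (ler_normD _ _))// !normrZ.
rewrite (ger0_norm t0) ger0_norm ?subr_ge0//.
have := ler_wpM2l t0 xx'; have : (1 - t) * `|y - y'| <= (1 - t) * (e + eta).
  by rewrite ler_wpM2l// subr_ge0.
by lra.
Qed.

Lemma sub_closed_convex_hull X : X `<=` closed_convex_hull X.
Proof. exact: sub_gen_smallest. Qed.

Lemma closed_convex_hull_sub X K :
  closed K -> convex_set K -> X `<=` K -> closed_convex_hull X `<=` K.
Proof. by move=> clK cK XK; apply: smallest_sub. Qed.

Lemma convex_closed_convex_hull X : convex_set (closed_convex_hull X).
Proof.
apply/convex_setP => x y t t01 Xx Xy K HK.
have [[_ /convex_setP cK] _] := HK.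
by apply: cK => //; [exact: (Xx K HK)|exact: (Xy K HK)].
Qed.

(** A closed convex set that contains X contains its closed convex hull, and a
    thickening of a convex set is closed and convex. *)
Lemma closed_convex_hull_thickening e X Y : X `<=` thickening e Y ->
  closed_convex_hull X `<=` thickening e (closed_convex_hull Y).
Proof.
move=> XY; apply: closed_convex_hull_sub.
- exact: closed_thickening.
- exact/convex_thickening/convex_closed_convex_hull.
- move=> x /XY Yx eta /Yx[y Yy xy]; exists y => //.
  exact: sub_closed_convex_hull.
Qed.

Lemma closed_convex_hull_norm_le (a : R) X x : (forall y, X y -> `|y| <= a) ->
  closed_convex_hull X x -> `|x| <= a.
Proof.
move=> Xa Xx; have : thickening a [set 0] x.
  apply: closed_convex_hull_sub Xx.
  - exact: closed_thickening.
  - apply: convex_thickening; apply/convex_setP => y z t _ /= -> ->.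
    by rewrite !scaler0 addr0.
  - move=> y /Xa ya eta eta0; exists 0 => //.
    by rewrite subr0 (le_trans ya)// lerDl ltW.
by move=> xa; apply/ler_addgt0Pr => e /xa[y /= ->]; rewrite subr0.
Qed.

(** The sum is a multiple of a barycentre; if all the weights vanish then any
    point of K serves, which is why K has to be nonempty. *)
Lemma convex_weighted_sum (I : Type) (r : seq I) (Q : pred I) (w : I -> R)
    (x : I -> E) K :
  convex_set K -> K !=set0 -> (forall i, Q i -> 0 <= w i) ->
  (forall i, Q i -> K (x i)) ->
  exists2 y, K y & \sum_(i <- r | Q i) w i *: x i = (\sum_(i <- r | Q i) w i) *: y.
Proof.
move=> /convex_setP cK [x0 Kx0] w0 Kx.
suff [_] : 0 <= \sum_(i <- r | Q i) w i /\ exists2 y, K y &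
    \sum_(i <- r | Q i) w i *: x i = (\sum_(i <- r | Q i) w i) *: y by [].
apply: (big_rec2 (fun (s : R) (v : E) => 0 <= s /\ exists2 y, K y & v = s *: y)).
  by split => //; exists x0; rewrite ?scale0r.
move=> i s v Qi [s0 [y Ky ->]].
have wi0 := w0 _ Qi; split; first by rewrite addr_ge0.
have [ws0|ws0] := eqVneq (s + w i) 0.
  have s00 : s = 0 by lra.
  have wi00 : w i = 0 by lra.
  by exists x0 => //; rewrite s00 wi00 !addr0 !scale0r addr0.
have ws_gt0 : 0 < w i + s by rewrite lt_neqAle addrC eq_sym ws0 addr_ge0.
exists (w i / (w i + s) *: x i + (1 - w i / (w i + s)) *: y).
  apply: cK => //; last exact: Kx.
  by rewrite divr_ge0 ?addr_ge0//= ler_pdivrMr// mul1r lerDl.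
rewrite scalerDr !scalerA; congr (_ *: _ + _ *: _); field; exact: lt0r_neq0.
Qed.

End Thickening.

(** * The Hausdorff distance in terms of thickenings *)
Section HausdorffDistance.
Context {R : realType} {E : completeNormedModType R}.
Implicit Types X Y Z : set E.

Lemma excess_lt X Y (e : R) x : (excess X Y < e%:E)%E -> X x ->
  exists2 y, Y y & `|x - y| < e.
Proof.
move=> XY Xx; have : (point_set_dist x Y < e%:E)%E.
  by apply: le_lt_trans XY; apply: ereal_sup_ubound; exists x.
by move/ereal_inf_lt => [_ [y Yy <-]]; rewrite lte_fin; exists y.
Qed.

Lemma excess_le X Y (e : R) : X `<=` thickening e Y -> (excess X Y <= e%:E)%E.
Proof.
move=> XY; apply: ge_ereal_sup => _ [x /XY Yx <-].
apply/lee_addgt0Pr => eta /Yx[y Yy xy]; apply: ge_ereal_inf.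
by exists (`|x - y|)%:E; [exists y|rewrite -EFinD lee_fin].
Qed.

Lemma hausdorff_dist_le X Y (e : R) : X `<=` thickening e Y ->
  Y `<=` thickening e X -> (hausdorff_dist X Y <= e%:E)%E.
Proof. by move=> XY YX; rewrite ge_max !excess_le. Qed.

Lemma hausdorff_dist_sym X Y : hausdorff_dist X Y = hausdorff_dist Y X.
Proof. exact: maxC. Qed.

Lemma hausdorff_dist_lt X Y (e : R) x : (hausdorff_dist X Y < e%:E)%E -> X x ->
  exists2 y, Y y & `|x - y| < e.
Proof. by rewrite gt_max => /andP[XY _]; exact: excess_lt. Qed.

Lemma hausdorff_dist_thickening X Y (e : R) :
  (hausdorff_dist X Y < e%:E)%E -> X `<=` thickening e Y.
Proof.
move=> XY x /(hausdorff_dist_lt XY)[y Yy xy] eta eta0; exists y => //.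
by rewrite (le_trans (ltW xy))// lerDl ltW.
Qed.

Lemma hausdorff_dist_ge0 X Y : X !=set0 -> (0 <= hausdorff_dist X Y)%E.
Proof.
move=> [x Xx]; rewrite le_max; apply/orP; left.
apply: (@le_trans _ _ (point_set_dist x Y)).
  by apply: le_ereal_inf_tmp => _ [y _ <-]; rewrite lee_fin.
by apply: ereal_sup_ubound; exists x.
Qed.

Lemma hausdorff_dist_triangle X Y Z (a b : R) : (hausdorff_dist X Y < a%:E)%E ->
  (hausdorff_dist Y Z < b%:E)%E -> (hausdorff_dist X Z < (a + b)%:E)%E.
Proof.
move=> XY YZ.
have [a' XYa' a'a] := ereal_lt_between XY.
apply: (@le_lt_trans _ _ (a' + b)%:E); last by rewrite lte_fin ltrD2r.
apply: hausdorff_dist_le.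
  exact: thickening_triangle (hausdorff_dist_thickening XYa') (hausdorff_dist_thickening YZ).
rewrite addrC; rewrite hausdorff_dist_sym in XYa'.
rewrite hausdorff_dist_sym in YZ.
exact: thickening_triangle (hausdorff_dist_thickening YZ) (hausdorff_dist_thickening XYa').
Qed.

End HausdorffDistance.

(** * Averages of hulls against weighted sums of hulls *)
Section WeightedSums.
Context {R : realType} {E : completeNormedModType R}.
Context (A : nat -> set E) (alpha : nat -> R) (p : nat -> R) (m : nat).
Context (A_neq0 : forall i, A i !=set0).
Context (A_le : forall i x, A i x -> `|x| <= alpha i).
Context (p_ge0 : forall i, 0 <= p i).

Definition weighted_hull_sum : set E :=
  [set z | exists2 b : nat -> E,
    forall i, (i < m)%N -> closed_convex_hull (A i) (b i) &
    z = \sum_(i < m) p i *: b i].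

(** Induction on the number j of terms that range over the hull of A i rather
    than over A i. When the other terms are fixed, the points x for which the
    sum stays in the thickening of C form a closed convex set, because that
    thickening is closed and convex; as this set contains A j, it contains its
    hull. *)
Lemma weighted_hull_sum_thickening (C : set E) (e : R) : convex_set C ->
  (forall a : nat -> E, (forall i, (i < m)%N -> A i (a i)) ->
     thickening e C (\sum_(i < m) p i *: a i)) ->
  weighted_hull_sum `<=` thickening e C.
Proof.
move=> cC AC _ [b Ab ->].
suff H : forall j, (j <= m)%N -> forall b : nat -> E,
    (forall i, (i < j)%N -> closed_convex_hull (A i) (b i)) ->
    (forall i, (j <= i < m)%N -> A i (b i)) ->
    thickening e C (\sum_(i < m) p i *: b i).
  apply: (H m) => // i /andP[mi im]; by rewrite ltnNge mi in im.
elim=> [_|j IH jm] {Ab}b Ab1 Ab2; first by apply: AC => i im; apply: Ab2.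
pose b' x i := if i == j then x else b i.
have sumE x : \sum_(i < m) p i *: b' x i =
    p j *: x + \sum_(i < m | i != j :> nat) p i *: b i.
  rewrite (bigD1 (Ordinal jm))//= /b' eqxx; congr (_ + _).
  by apply: eq_bigr => i /negbTE ij; rewrite -val_eqE/= in ij; rewrite ij.
have bE : \sum_(i < m) p i *: b i = \sum_(i < m) p i *: b' (b j) i.
  by apply: eq_bigr => i _; rewrite /b'; case: eqP => [->|].
pose K := [set x | thickening e C (p j *: x + \sum_(i < m | i != j :> nat) p i *: b i)].
suff : K (b j) by rewrite bE sumE.
have Ksub : closed_convex_hull (A j) `<=` K; last by apply: Ksub; apply: Ab1.
apply: closed_convex_hull_sub.
- move=> x /closureP Kx; apply: closed_thickening; apply/closureP => eta eta0.
  have [|y Ky xy] := Kx (eta / (p j + 1)); first by rewrite divr_gt0// ltr_wpDl.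
  exists (p j *: y + \sum_(i < m | i != j :> nat) p i *: b i) => //.
  rewrite opprD addrACA subrr addr0 -scalerBr normrZ ger0_norm//.
  rewrite (le_trans (ler_wpM2l _ xy))//.
  rewrite mulrCA ler_piMr ?(ltW eta0)// ler_pdivrMr ?ltr_wpDl//.
  by rewrite mul1r lerDl.
- apply/convex_setP => x y t t01 Kx Ky; rewrite /K /=.
  have -> : p j *: (t *: x + (1 - t) *: y) + \sum_(i < m | i != j :> nat) p i *: b i =
    t *: (p j *: x + \sum_(i < m | i != j :> nat) p i *: b i) +
    (1 - t) *: (p j *: y + \sum_(i < m | i != j :> nat) p i *: b i).
    move: (\sum_(i < m | _) _) => s; rewrite !scalerDr [RHS]addrACA -scalerDl.
    by rewrite (addrC t) subrK scale1r !scalerA ![_ * p j]mulrC.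
  by have /convex_setP := convex_thickening (e := e) cC; apply.
- move=> x Ax; rewrite /K /= -sumE; apply: IH; first exact: ltnW.
  + by move=> i ij; rewrite /b' ltn_eqF//; apply: Ab1; exact: ltnW.
  + move=> i /andP[]; rewrite /b' leq_eqVlt => /predU1P[<-|ji] im.
      by rewrite eqxx.
    by rewrite gtn_eqF//; apply: Ab2; rewrite ji.
Qed.

Context (n : nat) (iota : nat -> nat).

(** How far the first n.+1 indices iota k are from having the law p: the error in
    the frequency of every index below m, weighted by the size of A i, and the
    share of the larger indices. *)
Definition discrepancy : R :=
  \sum_(i < m) `|(\sum_(k < n.+1) (iota k == i)%:R) / n.+1%:R - p i| * alpha i +
  (\sum_(k < n.+1) (m <= iota k)%N%:R * alpha (iota k)) / n.+1%:R.

Lemma average_weighted_sum (a b : nat -> E) :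
  (forall k, (k < n.+1)%N -> `|a k| <= alpha (iota k)) ->
  (forall i, (i < m)%N -> `|b i| <= alpha i) ->
  (forall i, (i < m)%N -> \sum_(k < n.+1 | iota k == i) a k =
     (\sum_(k < n.+1) (iota k == i)%:R) *: b i) ->
  `|n.+1%:R^-1 *: (\sum_(k < n.+1) a k) - \sum_(i < m) p i *: b i| <= discrepancy.
Proof.
move=> a_le b_le ab.
rewrite (bigID (fun k : 'I_n.+1 => (iota k < m)%N))/=.
have -> : \sum_(k < n.+1 | (iota k < m)%N) a k =
    \sum_(i < m) (\sum_(k < n.+1) (iota k == i)%:R) *: b i.
  case: m ab b_le => [|m'] ab b_le.
    by rewrite big_ord0 big_pred0.
  rewrite (partition_big (fun k : 'I_n.+1 => inord (iota k) : 'I_m'.+1) xpredT)//=.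
  apply: eq_bigr => i _; rewrite -ab//; apply: eq_bigl => k.
  apply/andP/eqP => [[km /eqP <-]|->]; first by rewrite inordK.
  by rewrite ltn_ord inord_val.
rewrite scalerDr addrAC /discrepancy.
rewrite (le_trans (ler_normD _ _))// lerD//.
  rewrite scaler_sumr -sumrB (le_trans (ler_norm_sum _ _ _))//.
  apply: ler_sum => i _; rewrite scalerA -scalerBl normrZ mulrC.
  by rewrite mulrC [_^-1 * _]mulrC ler_wpM2l// b_le.
rewrite normrZ ger0_norm ?invr_ge0// mulrC ler_wpM2r ?invr_ge0//.
rewrite (le_trans (ler_norm_sum _ _ _))// big_mkcond/=.
apply: ler_sum => k _; rewrite -leqNgt; case: leqP => _; rewrite ?mul0r// mul1r.
exact: a_le.
Qed.

Context (X : nat -> set E) (e : R).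
Context (XA : forall k, (k < n.+1)%N -> X k `<=` thickening e (A (iota k))).
Context (AX : forall k, (k < n.+1)%N -> A (iota k) `<=` thickening e (X k)).

Let average := set_scale (n.+1%:R^-1) (closure (minkowski_sum
   (fun k : 'I_n.+1 => closed_convex_hull (X k)))).

Lemma norm_average_sub (x a : nat -> E) (c : R) :
  (forall k, (k < n.+1)%N -> `|x k - a k| <= c) ->
  `|n.+1%:R^-1 *: (\sum_(k < n.+1) x k) - n.+1%:R^-1 *: (\sum_(k < n.+1) a k)| <= c.
Proof.
move=> xac; rewrite -scalerBr normrZ ger0_norm ?invr_ge0// -sumrB.
rewrite ler_pdivrMl// (le_trans (ler_norm_sum _ _ _))//.
apply: (@le_trans _ _ (\sum_(k < n.+1) c)).
  by apply: ler_sum => k _; exact: xac.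
by rewrite sumr_const card_ord mulr_natl.
Qed.

Lemma average_sub_weighted_hull_sum :
  average `<=` thickening (e + discrepancy) weighted_hull_sum.
Proof.
move=> _ [s /closureP Ss <-] eta eta0.
have eta20 : 0 < eta / 2 by rewrite divr_gt0.
have [_ [x Xx <-] sx] := Ss _ eta20.
have /choice[a Aa] : forall k, exists a, (k < n.+1)%N ->
    closed_convex_hull (A (iota k)) a /\
    `|(if insub k is Some k' then x k' else 0) - a| <= e + eta / 2.
  move=> k; have [kn|_] := ltnP k n.+1; last by exists 0.
  have /(_ _ (Xx (Ordinal kn)) _ eta20)[a Aa xa] :=
    closed_convex_hull_thickening (XA kn).
  by exists a => _; rewrite insubT.
pose x' k := if insub k is Some k' then x k' else 0.
have x'E : \sum_(k < n.+1) x k = \sum_(k < n.+1) x' k.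
  by apply: eq_bigr => k _; rewrite /x' valK.
(* The points with the same index i are replaced by their barycentre b i. *)
have /choice[b Ab] : forall i, exists b, closed_convex_hull (A i) b /\
    \sum_(k < n.+1 | iota k == i) a k = (\sum_(k < n.+1) (iota k == i)%:R) *: b.
  move=> i.
  have [||||b Ab abE] := @convex_weighted_sum R E _ (index_enum 'I_n.+1)
      (fun k : 'I_n.+1 => iota k == i) (fun=> 1) (fun k => a k) (closed_convex_hull (A i)).
  - exact: convex_closed_convex_hull.
  - by have [y Ay] := A_neq0 i; exists y; exact: sub_closed_convex_hull.
  - by [].
  - by move=> k /eqP <-; have [] := Aa k (ltn_ord k).
  exists b; split => //; rewrite [in RHS]big_mkcond/= in abE.
  rewrite (eq_bigr (fun k : 'I_n.+1 => 1 *: a k)) ?abE; last by move=> *; rewrite scale1r.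
  by congr (_ *: _); apply: eq_bigr => k _; case: eqP.
exists (\sum_(i < m) p i *: b i); first by exists b => // i _; have [] := Ab i.
rewrite (le_trans (ler_distD (n.+1%:R^-1 *: \sum_(k < n.+1) x k) _ _))//.
have le1 : `|n.+1%:R^-1 *: s - n.+1%:R^-1 *: \sum_(k < n.+1) x k| <= eta / 2.
  rewrite -scalerBr normrZ ger0_norm ?invr_ge0// (le_trans _ sx)//.
  by rewrite ler_piMl// invf_le1// ler1n.
have le2 : `|n.+1%:R^-1 *: (\sum_(k < n.+1) x' k) - n.+1%:R^-1 *: (\sum_(k < n.+1) a k)| <= e + eta / 2.
  by apply: norm_average_sub => k kn; have [] := Aa k kn.
have le3 : `|n.+1%:R^-1 *: (\sum_(k < n.+1) a k) - \sum_(i < m) p i *: b i| <= discrepancy.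
  apply: average_weighted_sum.
  - move=> k kn; have [Aak _] := Aa k kn.
    exact: (closed_convex_hull_norm_le (@A_le (iota k))).
  - move=> i _; have [Abi _] := Ab i.
    exact: (closed_convex_hull_norm_le (@A_le i)).
  - by move=> i _; have [] := Ab i.
have := ler_distD (n.+1%:R^-1 *: \sum_(k < n.+1) a k)
  (n.+1%:R^-1 *: \sum_(k < n.+1) x k) (\sum_(i < m) p i *: b i).
rewrite x'E in le1 *; lra.
Qed.

Lemma weighted_hull_sum_sub_average :
  weighted_hull_sum `<=` thickening (e + discrepancy) average.
Proof.
move=> _ [b0 Ab0 ->] eta eta0.
have /choice[c Ac] : forall i, exists c, A i c by move=> i; have [c] := A_neq0 i; exists c.
(* b0 is constrained below m only; the indices from m on need points as well. *)
pose b i := if (i < m)%N then b0 i else c i.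
have Ab i : closed_convex_hull (A i) (b i).
  by rewrite /b; case: ltnP => im; [exact: Ab0|exact: sub_closed_convex_hull].
have /choice[x Xx] : forall k, exists x, (k < n.+1)%N ->
    closed_convex_hull (X k) x /\ `|b (iota k) - x| <= e + eta.
  move=> k; have [kn|_] := ltnP k n.+1; last by exists 0.
  have /(_ _ (Ab (iota k)) _ eta0)[x Xx bx] :=
    closed_convex_hull_thickening (AX kn).
  by exists x.
exists (n.+1%:R^-1 *: \sum_(k < n.+1) x k).
  exists (\sum_(k < n.+1) x k) => //; apply: subset_closure.
  by exists (fun k : 'I_n.+1 => x k) => // k; have [] := Xx k (ltn_ord k).
have -> : \sum_(i < m) p i *: b0 i = \sum_(i < m) p i *: b i.
  by apply: eq_bigr => i _; rewrite /b ltn_ord.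
have le2 : `|n.+1%:R^-1 *: (\sum_(k < n.+1) b (iota k)) - n.+1%:R^-1 *: (\sum_(k < n.+1) x k)| <= e + eta.
  by apply: (@norm_average_sub (b \o iota)) => k kn; have [] := Xx k kn.
have le3 : `|n.+1%:R^-1 *: (\sum_(k < n.+1) b (iota k)) - \sum_(i < m) p i *: b i| <= discrepancy.
  apply: (@average_weighted_sum (b \o iota)).
  - by move=> k kn; exact: (closed_convex_hull_norm_le (@A_le (iota k))).
  - by move=> i _; exact: (closed_convex_hull_norm_le (@A_le i)).
  - move=> i _; rewrite scaler_suml big_mkcond/=; apply: eq_bigr => k _.
    by case: eqP => [->|_]; rewrite ?scale1r ?scale0r.
have := ler_distD (n.+1%:R^-1 *: \sum_(k < n.+1) b (iota k))
  (\sum_(i < m) p i *: b i) (n.+1%:R^-1 *: \sum_(k < n.+1) x k).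
rewrite distrC in le3; lra.
Qed.

End WeightedSums.

(** * Measurability of random sets and Borel partitions *)
Section BorelCells.
Context {R : realType} {E : completeNormedModType R}.
Context {d : measure_display} {T : measurableType d}.
Context (P : probability T R) (P_complete : measure_is_complete P).
Implicit Types U : set (set E).

Lemma measurable_countably_valued {V : Type} (D : set V) (g : T -> V) (S : set V) :
  countably_valued D g -> measurable (g @^-1` S).
Proof.
move=> [a [B [_ mB _ BT gB]]].
rewrite [X in measurable X](_ : _ = \bigcup_(i in [set i | S (a i)]) B i).
  by apply: bigcup_measurable => i _; exact: mB.
apply/seteqP; split => [w Sgw|w [i Si Biw]].
  have : setT w by [].
  rewrite -BT => -[i _ Biw]; exists i => //=.
  by rewrite -(gB _ _ Biw).
by rewrite /= (gB _ _ Biw).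
Qed.

(** Outside the null set N, the distance from F w to A is less than e if and only
    if some approximation of F within 1 / (k + 1) is at distance less than
    e - 1 / (k + 1) from A. Completeness takes care of what happens on N. *)
Lemma measurable_hausdorff_ball (F : T -> set E) (A : set E) (e : R) :
  strongly_measurable P F -> measurable [set w | (hausdorff_dist (F w) A < e%:E)%E].
Proof.
move=> [_ [G [G_cv GF]]].
have /choice[n_ n_P] : forall k, exists n,
    {ae P, forall w, (hausdorff_dist (G n w) (F w) < (k.+1%:R^-1)%:E)%E}.
  move=> k; have k0 : 0 < k.+1%:R^-1 :> R by rewrite invr_gt0.
  have [n _ nP] := GF _ (@nbhs_open_ereal_lt R 0 (fun=> k.+1%:R^-1) k0).
  exists n; have := nP n (leqnn n) => /= lt.
  by apply: filterS (ess_sup_ge P (fun w => hausdorff_dist (G n w) (F w))) => w /le_lt_trans; apply.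
pose N := ~` [set w | forall k, (hausdorff_dist (G (n_ k) w) (F w) < (k.+1%:R^-1)%:E)%E].
have negN : P.-negligible N by have := ae_foralln n_P.
have mN : measurable N by exact: P_complete.
pose S' := \bigcup_k [set w | (hausdorff_dist (G (n_ k) w) A < (e - k.+1%:R^-1)%:E)%E].
have mS' : measurable S'.
  apply: bigcup_measurable => k _.
  exact: (measurable_countably_valued
    (fun Y => hausdorff_dist Y A < (e - k.+1%:R^-1)%:E)%E (G_cv (n_ k))).
set S := (X in measurable X).
have SN : S = (S' `\` N) `|` (S `&` N).
  apply/seteqP; split => [w Sw|w [[S'w]|[]//]].
    have [Nw|nNw] := pselect (N w); [by right|left; split => //].
    have GFw : forall k, (hausdorff_dist (G (n_ k) w) (F w) < (k.+1%:R^-1)%:E)%E.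
      exact: contrapT.
    have [r Fr re] := ereal_lt_between Sw.
    have er0 : 0 < (e - r) / 2 by rewrite divr_gt0// subr_gt0.
    have [k] := ltr_add_invr er0; rewrite add0r => ke.
    exists k => //=; apply: (lt_le_trans (hausdorff_dist_triangle (GFw k) Fr)).
    by rewrite lee_fin; move: (_^-1) ke => x ke; lra.
  move=> nNw; case: S'w => k _ /= GA.
  have /(_ k) : forall k, (hausdorff_dist (G (n_ k) w) (F w) < (k.+1%:R^-1)%:E)%E.
    exact: contrapT.
  rewrite hausdorff_dist_sym => FG.
  by have := hausdorff_dist_triangle FG GA; rewrite addrC subrK.
rewrite SN; apply: measurableU; first exact: measurableD.
by apply: P_complete; apply: negligibleS negN; exact: subIsetr.
Qed.

Lemma hausdorff_dense_sequence U : U !=set0 -> hausdorff_separable U ->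
  exists A : nat -> set E, (forall i, U (A i)) /\
    forall X (e : R), U X -> 0 < e -> exists i, (hausdorff_dist X (A i) < e%:E)%E.
Proof.
move=> [X0 UX0] [D [/countable_injP[f f_inj] DU Ddense]].
exists (fun i => xget X0 [set Y | D Y /\ f Y = i]); split.
  by move=> i; case: xgetP => [Y _ [/DU]|].
move=> X e UX e0; have [Y DY XY] := Ddense X e UX e0.
exists (f Y); case: xgetP => [Z _ [DZ fZY]|/(_ Y)]; last by case.
by have <- : Y = Z by apply: f_inj; rewrite ?inE.
Qed.

Lemma hausdorff_open_ball U (A : set E) (e : R) :
  hausdorff_open U [set X | U X /\ (hausdorff_dist X A < e%:E)%E].
Proof.
split => [X []//|X [UX XA]].
have [r Xr re] := ereal_lt_between XA.
exists (e - r) => [|Y UY XY]; first by rewrite subr_gt0.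
split => //; rewrite hausdorff_dist_sym in XY.
by have := hausdorff_dist_triangle XY Xr; rewrite subrK.
Qed.

(** It suffices to consider open sets, and in a separable space these are
    countable unions of balls. *)
Lemma measurable_hausdorff_borel U (F : T -> set E) (B : set (set E)) :
  U !=set0 -> hausdorff_separable U ->
  strongly_measurable P F -> (forall w, U (F w)) ->
  hausdorff_borel U B -> measurable (F @^-1` B).
Proof.
move=> U0 sepU mF FU; have [A [AU Adense]] := hausdorff_dense_sequence U0 sepU.
suff : hausdorff_borel U `<=` [set B | measurable (F @^-1` B)] by apply.
apply: smallest_sub.
  split => /=.
  - by rewrite preimage_set0.
  - move=> C mC; rewrite (_ : _ @^-1` _ = ~` (F @^-1` C)); first exact: measurableC.
    by apply/seteqP; split => [w []//|w nC]; split.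
  - by move=> C mC; rewrite preimage_bigcup; exact: bigcup_measurable.
move=> V [VU V_open] /=.
pose ball i k := [set Y | (hausdorff_dist Y (A i) < (k.+1%:R^-1)%:E)%E].
rewrite (_ : F @^-1` V = \bigcup_i \bigcup_(k in [set k | ball i k `&` U `<=` V])
    (F @^-1` (ball i k))).
  by do 2 (apply: bigcup_measurable => ? _); exact: measurable_hausdorff_ball.
apply/seteqP; split => [w /= VFw|w [i _ [k /= kV Fik]]]; last by apply: kV; split.
have [e e0 eV] := V_open _ VFw.
have e20 : 0 < e / 2 by rewrite divr_gt0.
have [k] := ltr_add_invr e20; rewrite add0r => ke.
have k0 : 0 < k.+1%:R^-1 :> R by rewrite invr_gt0.
have [i FAi] := Adense _ _ (FU w) k0.
exists i => //; exists k => //= Y [YA UY]; apply: eV => //.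
rewrite /ball /= hausdorff_dist_sym in YA.
apply: lt_le_trans (hausdorff_dist_triangle FAi YA) _.
by rewrite lee_fin; move: (_^-1) ke => x ke; lra.
Qed.

(** The cell of index i consists of the members of U that are within e of A i but
    of no A j with j < i. *)
Lemma borel_cells U (e : R) : U !=set0 -> hausdorff_separable U -> 0 < e ->
  exists (A : nat -> set E) (idx : set E -> nat), [/\ forall i, U (A i),
    forall X, U X -> (hausdorff_dist X (A (idx X)) < e%:E)%E &
    forall S : set nat, hausdorff_borel U [set X | U X /\ S (idx X)]].
Proof.
move=> U0 sepU e0; have [A [AU Adense]] := hausdorff_dense_sequence U0 sepU.
pose B i := [set X | U X /\ (hausdorff_dist X (A i) < e%:E)%E].
have /choice[idx idxP] : forall X, exists i, U X -> seqDU B i X.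
  move=> X; have [UX|nUX] := pselect (U X); last by exists 0%N.
  have [i XAi] := Adense X e UX e0.
  have : (\bigcup_i B i) X by exists i.
  by rewrite seqDU_bigcup_eq => -[j _ Bj]; exists j.
have borelB i : hausdorff_borel U (B i).
  by apply: sub_sigma_algebra; exact: hausdorff_open_ball.
have borelU (V W : set (set E)) : hausdorff_borel U V -> hausdorff_borel U W ->
    hausdorff_borel U (V `|` W).
  move=> bV bW; rewrite -bigcup2E; apply: sigma_algebra_bigcup => -[|[|n]]//=.
  exact: sigma_algebra0.
have borelD i : hausdorff_borel U (seqDU B i).
  rewrite (_ : seqDU B i = U `\` ((U `\` B i) `|` \big[setU/set0]_(k < i) B k)).
    apply: sigma_algebraCD; apply: (borelU); first by apply: sigma_algebraCD; exact: borelB.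
    apply: (big_ind (hausdorff_borel U)) => [|V W|k _].
    - exact: sigma_algebra0.
    - exact: borelU.
    - exact: borelB.
  rewrite /seqDU; apply/seteqP; split => [X [BX nX]|X [UX nX]].
    by split; [case: BX|move=> [[_]//|]].
  split; last by move=> ?; apply: nX; right.
  by apply: contrapT => nBX; apply: nX; left.
exists A, idx; split => // [X UX|S].
  by have [[]] := idxP X UX.
rewrite (_ : [set X | _] = \bigcup_i (if i \in S then seqDU B i else set0)).
  apply: sigma_algebra_bigcup => i; by case: ifP => _; [exact: borelD|exact: sigma_algebra0].
apply/seteqP; split => [X /= [UX SX]|X [i _]].
  by exists (idx X) => //; rewrite mem_set//; exact: idxP.
case: ifPn => //; rewrite inE => Si BX; have UX : U X by case: BX => -[].
split => //; suff -> : idx X = i by [].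
by apply: (@trivIset_seqDU _ B (idx X) i) => //; exists X; split => //; exact: idxP.
Qed.

End BorelCells.

(** * Simple maps and their integrals *)
Section FiniteIndex.
Context {R : realType} {d : measure_display} {T : measurableType d}.
Context (P : probability T R).
Context (J : finType) (kappa : T -> J).
Context (mkappa : forall j, measurable (kappa @^-1` [set j])).

Lemma measurable_finite_index (S : set J) : measurable (kappa @^-1` S).
Proof.
rewrite (_ : _ @^-1` _ = \bigcup_(j in S) (kappa @^-1` [set j])).
  by apply: fin_bigcup_measurable => //; exact: finite_finset.
by apply/seteqP; split => [w Sw|w [j jS /= wj]]; [exists (kappa w)|rewrite /= wj].
Qed.

Lemma integral_finite_index (f : J -> R) : (forall j, 0 <= f j) ->
  (\int[P]_w (f (kappa w))%:E =
   (\sum_j fine (P (kappa @^-1` [set j])) * f j)%:E)%E.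
Proof.
move=> f0.
transitivity (\int[P]_w (\sum_j ((f j)%:E * (\1_(kappa @^-1` [set j]) w)%:E)))%E.
  apply: eq_integral => w _; rewrite (bigD1 (kappa w))//= big1.
    by rewrite indicE mem_set// mule1 adde0.
  by move=> j jw; rewrite indicE memNset ?mule0//= => wj; rewrite wj eqxx in jw.
rewrite ge0_integral_sum//=; last 2 first.
- by move=> j; apply: measurable_funeM; exact/measurable_EFinP/measurable_indic.
- by move=> j w _; rewrite mule_ge0 ?lee_fin.
rewrite -sumEFin; apply: eq_bigr => j _.
rewrite ge0_integralZl//; last 2 first.
- exact/measurable_EFinP/measurable_indic.
- by rewrite lee_fin.
by rewrite integral_indic// setIT muleC EFinM fineK// fin_num_measure.
Qed.

Lemma probability_finite_index (S : set J) :
  fine (P (kappa @^-1` S)) = \sum_(j | j \in S) fine (P (kappa @^-1` [set j])).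
Proof.
have mS := measurable_finite_index S.
have -> : P (kappa @^-1` S) = (\int[P]_w (\1_S (kappa w))%:E)%E.
  transitivity (\int[P]_w (\1_(kappa @^-1` S) w)%:E)%E.
    by rewrite integral_indic// setIT.
  by apply: eq_integral => w _; rewrite !indicE.
rewrite integral_finite_index//= [RHS]big_mkcond/=.
by apply: eq_bigr => j _; rewrite indicE; case: (_ \in _); rewrite ?mulr1 ?mulr0.
Qed.

Context {E : completeNormedModType R}.

Lemma simple_map_finite_index (c : J -> E) : simple_map (c \o kappa).
Proof.
split; last by move=> v; exact: (measurable_finite_index (c @^-1` [set v])).
apply: (@sub_finite_set _ _ (range c)); first by move=> _ [w _ <-]; exists (kappa w).
exact/finite_image/finite_finset.
Qed.

(** The indices at which c takes the same value are grouped; those that kappa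
    never attains have probability 0. *)
Lemma simple_integral_finite_index (c : J -> E) :
  simple_integral P (c \o kappa) = \sum_j fine (P (kappa @^-1` [set j])) *: c j.
Proof.
have [fin_c _] := simple_map_finite_index c.
rewrite /simple_integral fsbig_finite//=.
transitivity (\sum_(v <- fset_set (range (c \o kappa)))
    \sum_j (if c j == v then fine (P (kappa @^-1` [set j])) *: c j else 0)).
  apply: eq_bigr => v _; rewrite -big_mkcond/=.
  rewrite (probability_finite_index (c @^-1` [set v])) scaler_suml.
  apply: eq_big => [j|j]; first by apply/idP/eqP; rewrite inE.
  by rewrite inE /= => ->.
rewrite exchange_big/=; apply: eq_bigr => j _.
have [cj|cj] := boolP (c j \in fset_set (range (c \o kappa))).
  rewrite (bigD1_seq (c j)) ?fset_uniq//= eqxx big1 ?addr0// => v.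
  by rewrite eq_sym => /negbTE ->.
rewrite big_seq big1; last first.
  by move=> v vc; case: eqP => // cv; rewrite cv vc in cj.
rewrite (_ : kappa @^-1` [set j] = set0) ?measure0 ?scale0r//.
apply/seteqP; split => // w /= wj; move/negP: cj; apply.
by rewrite in_fset_set// inE; exists w => //=; rewrite wj.
Qed.

End FiniteIndex.

Section SimpleIntegral.
Context {R : realType} {E : completeNormedModType R}.
Context {d : measure_display} {T : measurableType d}.
Context (P : probability T R).

(** Two simple maps can thus be read off a common finite index, the pair of their
    indices; this replaces the construction of common refinements of
    partitions. *)
Lemma simple_map_factor (s : T -> E) : simple_map s ->
  exists (J : finType) (kappa : T -> J) (c : J -> E),
    (forall j, measurable (kappa @^-1` [set j])) /\ s = c \o kappa.
Proof.
move=> [fin_s ms].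
have sP w : s w \in fset_set (range s) by rewrite in_fset_set// inE; exists w.
exists (fset_set (range s)), (fun w => [` sP w]%fset), val; split => //.
move=> j; rewrite (_ : _ @^-1` _ = s @^-1` [set val j])//.
by apply/seteqP; split => w /=; [move=> <-|move=> ?; exact: val_inj].
Qed.

Lemma measurable_pair_finite_index (J1 J2 : finType) (k1 : T -> J1) (k2 : T -> J2) :
  (forall j, measurable (k1 @^-1` [set j])) ->
  (forall j, measurable (k2 @^-1` [set j])) ->
  forall j, measurable ((fun w => (k1 w, k2 w)) @^-1` [set j]).
Proof.
move=> m1 m2 [j1 j2].
rewrite (_ : _ @^-1` _ = k1 @^-1` [set j1] `&` k2 @^-1` [set j2]).
  exact: measurableI.
by apply/seteqP; split => w /=; [case=> -> ->|case=> -> ->].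
Qed.

Lemma simple_map_normB (s t : T -> E) : simple_map s -> simple_map t ->
  measurable_fun setT (fun w => `|s w - t w|).
Proof.
move=> /simple_map_factor[J1 [k1 [c1 [mk1 ->]]]] /simple_map_factor[J2 [k2 [c2 [mk2 ->]]]].
exact: (measurable_fun_index (fun j => `|c1 j.1 - c2 j.2|)
  (measurable_finite_index (measurable_pair_finite_index mk1 mk2))).
Qed.

Lemma simple_integral_dist (s t : T -> E) : simple_map s -> simple_map t ->
  ((`|simple_integral P s - simple_integral P t|)%:E <= \int[P]_w (`|s w - t w|)%:E)%E.
Proof.
move=> /simple_map_factor[J1 [k1 [c1 [mk1 ->]]]] /simple_map_factor[J2 [k2 [c2 [mk2 ->]]]].
have mk := measurable_pair_finite_index mk1 mk2.
pose k w := (k1 w, k2 w).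
rewrite (_ : c1 \o k1 = (fun j => c1 j.1) \o k)//.
rewrite (_ : c2 \o k2 = (fun j => c2 j.2) \o k)//.
rewrite !(simple_integral_finite_index P mk).
rewrite (integral_finite_index P mk (f := fun j => `|c1 j.1 - c2 j.2|))//.
rewrite lee_fin -sumrB (le_trans (ler_norm_sum _ _ _))//.
by apply: ler_sum => j _; rewrite -scalerBr normrZ ger0_norm// fine_ge0.
Qed.

End SimpleIntegral.

(** * Monotonicity without measurability *)
Section LowerIntegral.
Context {R : realType} {d : measure_display} {T : measurableType d}.
Context (P : probability T R).

Import HBNNSimple.

(** The integral of a nonnegative function is a supremum over the simple
    functions below it, so that comparisons hold without measurability. They
    are applied to norms of differences that involve arbitrary selections. *)
Lemma ge0_le_lower_integral (u v : T -> \bar R) :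
  (forall w, 0 <= u w)%E -> (forall w, u w <= v w)%E ->
  (\int[P]_w u w <= \int[P]_w v w)%E.
Proof.
move=> u0 uv; have v0 w : (0 <= v w)%E by exact: le_trans (uv w).
rewrite !ge0_integralTE//; apply: ereal_sup_le => _ [h hu <-].
by exists h => // w; exact: le_trans (uv w).
Qed.

(** The function max (u - g) 0 is measurable and lies below v, which is
    arbitrary. *)
Lemma integral_le_add (u g v : T -> R) :
  measurable_fun setT u -> measurable_fun setT g ->
  (forall w, 0 <= u w) -> (forall w, 0 <= g w) -> (forall w, 0 <= v w) ->
  (forall w, u w <= v w + g w) ->
  (\int[P]_w (u w)%:E <= \int[P]_w (v w)%:E + \int[P]_w (g w)%:E)%E.
Proof.
move=> mu mg u0 g0 v0 uvg.
pose h w := Num.max (u w - g w) 0.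
have mh : measurable_fun setT h.
  by apply: measurable_maxr => //; exact: measurable_funB.
have h0 w : 0 <= h w by rewrite le_max lexx orbT.
apply: (@le_trans _ _ (\int[P]_w ((h w)%:E + (g w)%:E))%E).
  apply: ge0_le_lower_integral => w; first by rewrite lee_fin.
  by rewrite -EFinD lee_fin -lerBlDr le_max lexx.
rewrite ge0_integralD//; [|by move=> w _; rewrite lee_fin|exact/measurable_EFinP
  |by move=> w _; rewrite lee_fin|exact/measurable_EFinP].
apply: leeD2r; apply: ge0_le_lower_integral => w; first by rewrite lee_fin.
by rewrite lee_fin ge_max v0 lerBlDr uvg.
Qed.

End LowerIntegral.

(** * Bochner integrals *)
Section GeometricCauchy.
Context {R : realType}.

Lemma geometric_lt (K e : R) : 0 < e -> exists N, forall n, (N <= n)%N -> K / 2 ^+ n < e.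
Proof.
move=> e0.
have /cvg_geometric : `|2^-1 : R| < 1 by rewrite ger0_norm// invf_lt1// ltr1n.
move=> /(_ K)/cvgr0Pnorm_lt/(_ e e0)[N _ NP].
exists N => n Nn; have := NP n Nn; rewrite /= exprVn.
by apply: le_lt_trans; exact: ler_norm.
Qed.

Lemma geometric_cauchy_cvg (E : completeNormedModType R) (u : nat -> E) (K : R) :
  (forall n k, (n <= k)%N -> `|u n - u k| <= K / 2 ^+ n) ->
  exists2 l, u n @[n --> \oo] --> l & forall n, `|u n - l| <= K / 2 ^+ n.
Proof.
move=> uK.
have : cvg (u @ \oo).
  apply/cauchy_cvgP/cauchy_ballP => e e0; near_simpl.
  have [N NP] := geometric_lt K e0.
  exists ([set n | (N <= n)%N], [set n | (N <= n)%N]).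
    by split; exists N.
  move=> [i j] [/= Ni Nj]; rewrite -ball_normE /=.
  have [ij|ji] := leqP i j; first exact: le_lt_trans (uK _ _ ij) (NP _ Ni).
  by rewrite distrC; exact: le_lt_trans (uK _ _ (ltnW ji)) (NP _ Nj).
move=> /cvg_ex[l ul]; exists l => // n; apply/ler_addgt0Pr => e e0.
have /cvgrPdist_le/(_ e e0)[N _ NP] := ul.
rewrite (le_trans (ler_distD (u (maxn n N)) _ _))// lerD// ?uK ?leq_maxl//.
by rewrite distrC; apply: NP => /=; exact: leq_maxr.
Qed.

End GeometricCauchy.

Section Bochner.
Context {R : realType} {E : completeNormedModType R}.
Context {d : measure_display} {T : measurableType d}.
Context (P : probability T R).

Lemma integral_tail_le (beta : T -> R) (kappa : T -> nat) (e : R) :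
  measurable_fun setT beta -> (forall w, 0 <= beta w) ->
  (\int[P]_w (beta w)%:E < +oo)%E ->
  (forall S, measurable (kappa @^-1` S)) -> 0 < e ->
  exists M, (\int[P]_w (beta w * (M <= kappa w)%N%:R)%:E <= e%:E)%E.
Proof.
move=> mbeta beta0 beta_fin mkappa e0.
have mind M : measurable_fun setT (fun w => (M <= kappa w)%N%:R : R).
  exact: (measurable_fun_index (fun k => (M <= k)%N%:R)).
have [_ _] : [/\ P.-integrable setT (cst 0%E),
    [sequence \int[P]_w `|(beta w * (n <= kappa w)%N%:R)%:E - 0|]_n @ \oo --> 0 &
    [sequence \int[P]_w (beta w * (n <= kappa w)%N%:R)%:E]_n @ \oo --> \int[P]_w (cst 0 w)]%E.
  apply: (@dominated_convergence _ _ _ P setT measurableT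
    (fun n w => (beta w * (n <= kappa w)%N%:R)%:E) (cst 0%E) (fun w => (beta w)%:E)).
  - by move=> n; exact/measurable_EFinP/measurable_funM.
  - by [].
  - apply: aeW => w _; apply: (@cvg_near_cst _ _ _ _ eventually).
    by exists (kappa w).+1 => // n /=; rewrite ltnNge => /negbTE ->; rewrite mulr0.
  - apply/integrableP; split; first exact/measurable_EFinP.
    by under eq_integral do rewrite gee0_abs ?lee_fin//.
  - apply: aeW => w n _; rewrite gee0_abs ?lee_fin ?mulr_ge0//.
    by case: (_ <= _)%N; rewrite ?mulr1 ?mulr0.
rewrite integral0 => /(_ _ (@nbhs_open_ereal_lt R 0 (fun=> e) e0))[M _ MP].
by exists M; apply: ltW; exact: (MP M (leqnn M)).
Qed.

(** The n-th simple approximation keeps the values of the n-th countably-valued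
    one whose index is less than M n, and is 0 elsewhere. Choosing M n so that
    the integral of beta + 1 over the discarded event is at most 1 / 2 ^ n
    gives the convergence of the integrals, thanks to beta, and the almost sure
    convergence, thanks to 1 and the Borel-Cantelli lemma. *)
Lemma bochner_integrable (f : T -> E) (kappa : nat -> T -> nat)
    (c : nat -> nat -> E) (K : R) (beta : T -> R) :
  (forall n S, measurable (kappa n @^-1` S)) ->
  (forall n w, `|f w - c n (kappa n w)| <= K / 2 ^+ n) ->
  measurable_fun setT beta -> (forall w, `|f w| <= beta w) ->
  (\int[P]_w (beta w)%:E < +oo)%E ->
  exists I, bochner_integral P f I.
Proof.
move=> mkappa fc mbeta f_le beta_fin.
have beta0 w : 0 <= beta w by exact: le_trans (f_le w).
have K0 : 0 <= K.
  by have := fc 0%N point; rewrite expr0 divr1; exact: le_trans.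
have p0 n : 0 < 2 ^+ n :> R by rewrite exprn_gt0.
have beta1_fin : (\int[P]_w (beta w + 1)%:E < +oo)%E.
  under eq_integral do rewrite EFinD.
  rewrite ge0_integralD//; last 2 first.
  - by move=> w _; rewrite lee_fin.
  - exact/measurable_EFinP.
  by rewrite integral_probability_cst lte_add_pinfty// ltry.
have /choice[M MP] : forall n, exists M,
    (\int[P]_w ((beta w + 1) * (M <= kappa n w)%N%:R)%:E <= (2 ^+ n)^-1%:E)%E.
  move=> n; apply: integral_tail_le => //.
  - exact: measurable_funD.
  - by move=> w; rewrite addr_ge0.
pose s n w := if (kappa n w < M n)%N then c n (kappa n w) else 0.
pose J n w : 'I_(M n).+1 := inord (minn (kappa n w) (M n)).
have mJ n j : measurable (J n @^-1` [set j]).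
  exact: (mkappa n [set k | inord (minn k (M n)) = j]).
have sE n : s n = (fun j : 'I_(M n).+1 => if (j < M n)%N then c n j else 0) \o J n.
  apply/funext => w; rewrite /s /J /= inordK ?ltnS ?geq_minr//.
  have [kM|Mk] := ltnP (kappa n w) (M n); first by rewrite kM.
  by rewrite ltnn.
have simple_s n : simple_map (s n) by rewrite sE; exact: (simple_map_finite_index (mJ n)).
pose u n w := K / 2 ^+ n + (beta w + 1) * (M n <= kappa n w)%N%:R.
have mind n : measurable_fun setT (fun w => (M n <= kappa n w)%N%:R : R).
  exact: (measurable_fun_index (fun k => (M n <= k)%N%:R)).
have mu n : measurable_fun setT (u n).
  by apply: measurable_funD => //; apply: measurable_funM => //; exact: measurable_funD.
have Kp0 n : 0 <= K / 2 ^+ n by rewrite divr_ge0// ltW.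
have u0 n w : 0 <= u n w by rewrite addr_ge0// mulr_ge0// addr_ge0.
have fsu n w : `|f w - s n w| <= u n w.
  rewrite /s /u; case: ltnP => _; first by rewrite mulr0 addr0.
  by rewrite subr0 mulr1 (le_trans (f_le w))// addrCA lerDl addr_ge0.
have Iu n : (\int[P]_w (u n w)%:E <= ((K + 1) / 2 ^+ n)%:E)%E.
  under eq_integral do rewrite EFinD.
  rewrite ge0_integralD//; last 3 first.
  - by move=> w _; rewrite lee_fin.
  - by move=> w _; rewrite lee_fin mulr_ge0// addr_ge0.
  - by apply/measurable_EFinP; apply: measurable_funM => //; exact: measurable_funD.
  rewrite integral_probability_cst.
  by rewrite mulrDl EFinD mul1r leeD2l.
have cauchy n k : (n <= k)%N ->
    `|simple_integral P (s n) - simple_integral P (s k)| <= (2 * (K + 1)) / 2 ^+ n.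
  move=> nk; rewrite -lee_fin.
  apply: (le_trans (simple_integral_dist P (simple_s n) (simple_s k))).
  apply: (@le_trans _ _ (\int[P]_w ((u n w)%:E + (u k w)%:E))%E).
    apply: ge0_le_lower_integral => w; first by rewrite lee_fin.
    rewrite -EFinD lee_fin (le_trans (ler_distD (f w) _ _))//.
    by rewrite lerD// distrC.
  rewrite ge0_integralD//; last 4 first.
  - by move=> w _; rewrite lee_fin.
  - exact/measurable_EFinP.
  - by move=> w _; rewrite lee_fin.
  - exact/measurable_EFinP.
  apply: (le_trans (leeD (Iu n) (Iu k))).
  rewrite -EFinD lee_fin -mulrA mulr_natl mulr2n lerD2l ler_wpM2l ?addr_ge0//.
  by rewrite lef_pV2 ?posrE// ler_weXn2l// lerDl.
have [I sI _] := geometric_cauchy_cvg cauchy.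
exists I, s; split => //.
- pose F n := [set w | (M n <= kappa n w)%N].
  have PF n : (P (F n) <= ((2 ^+ n)^-1)%:E)%E.
    apply: le_trans (MP n).
    have -> : P (F n) = (\int[P]_w (\1_(F n) w)%:E)%E.
      rewrite integral_indic// ?setIT//.
      exact: (mkappa n [set k | (M n <= k)%N]).
    apply: ge0_le_lower_integral => w; first by rewrite lee_fin.
    rewrite lee_fin indicE; case: (boolP (_ \in _)) => [|_]; last first.
      by rewrite mulr_ge0// addr_ge0.
    by rewrite inE /F /= => ->; rewrite mulr1 lerDr.
  have mF n : measurable (F n) by exact: (mkappa n [set k | (M n <= k)%N]).
  have SF N : (\sum_(n < N) P (F n) <= 2%:E)%E.
    apply: (@le_trans _ _ (\sum_(n < N) ((2 ^+ n)^-1)%:E)%E).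
      by apply: lee_sum => n _.
    rewrite sumEFin lee_fin.
    suff -> : \sum_(n < N) (2 ^+ n)^-1 = 2 - 2 / 2 ^+ N :> R.
      by rewrite gerBl divr_ge0// ltW.
    elim: N => [|N IH]; first by rewrite big_ord0 expr0; lra.
    rewrite big_ord_recr/= IH exprS; have := lt0r_neq0 (p0 N).
    by move: (2 ^+ N) => p pn0; field.
  apply: filterS (ae_eventually_not mF SF) => w [N1 _ N1P].
  apply/cvgrPdist_le => e e0; have [N2 N2P] := geometric_lt K e0.
  exists (maxn N1 N2) => // n /=; rewrite geq_max => /andP[N1n N2n].
  have /negP := N1P _ N1n; rewrite /F /= -ltnNge => kM.
  rewrite (le_trans _ (ltW (N2P _ N2n)))// (le_trans (fsu n w))//.
  by rewrite /u leqNgt kM mulr0 addr0.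
- apply: (@squeeze_cvge _ _ _ _ (fun=> 0%E) _ (fun n => ((K + 1) / 2 ^+ n)%:E)).
  + apply: nearW => n; apply/andP; split.
      by apply: integral_ge0 => w _; rewrite lee_fin.
    apply: le_trans (Iu n); apply: ge0_le_lower_integral => w.
      by rewrite lee_fin.
    by rewrite lee_fin.
  + exact: cvg_cst.
  + apply/cvg_EFin; first exact: nearW.
    apply/cvgr0Pnorm_lt => e e0; have [N NP] := geometric_lt (K + 1) e0.
    exists N => // n /= Nn; rewrite ger0_norm ?NP// divr_ge0 ?addr_ge0// ltW//.
Qed.

(** The integral of f is compared with that of t through any simple map close to f
    in mean. *)
Lemma bochner_integral_dist (f : T -> E) (I : E) (t : T -> E) (g : T -> R) (C : R) :
  bochner_integral P f I -> simple_map t -> measurable_fun setT g ->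
  (forall w, 0 <= g w) -> (forall w, `|f w - t w| <= g w) ->
  (\int[P]_w (g w)%:E <= C%:E)%E ->
  `|I - simple_integral P t| <= C.
Proof.
move=> [s [simple_s _ sf sI]] simple_t mg g0 ftg gC.
apply/ler_addgt0Pr => e e0; have e20 : 0 < e / 2 by rewrite divr_gt0.
have [N1 _ N1P] := sf _ (@nbhs_open_ereal_lt R 0 (fun=> e / 2) e20).
have /cvgrPdist_le/(_ _ e20)[N2 _ N2P] := sI.
pose n := maxn N1 N2.
have Is := N2P n (leq_maxr _ _).
have fs := N1P n (leq_maxl _ _).
have st : `|simple_integral P (s n) - simple_integral P t| <= C + e / 2.
  rewrite -lee_fin (le_trans (simple_integral_dist P (simple_s n) simple_t))//.
  rewrite EFinD addeC.
  apply: le_trans (leeD (ltW fs) gC).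
  apply: integral_le_add => //; first exact: simple_map_normB.
  move=> w; rewrite (le_trans (ler_distD (f w) _ _))// lerD//.
  by rewrite distrC.
have := ler_distD (simple_integral P (s n)) I (simple_integral P t).
have {}Is : `|I - simple_integral P (s n)| <= e / 2 by [].
lra.
Qed.

End Bochner.

(** * Measurable selections *)
Lemma geometric_steps {R : realType} {E : completeNormedModType R} (u : nat -> E) (K : R) :
  (forall n, `|u n - u n.+1| <= K / 2 ^+ n) ->
  forall n k, (n <= k)%N -> `|u n - u k| <= (2 * K) / 2 ^+ n.
Proof.
move=> uK n k /subnKC <-; move: (k - n)%N => {k}j.
have p0 i : 0 < 2 ^+ i :> R by rewrite exprn_gt0.
have K0 : 0 <= K by have := uK 0%N; rewrite expr0 divr1; exact: le_trans.
apply: (@le_trans _ _ (2 * K / 2 ^+ n - 2 * K / 2 ^+ (n + j))); last first.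
  by rewrite gerBl divr_ge0 ?mulr_ge0// ltW.
elim: j => [|j IH]; first by rewrite addn0 !subrr normr0.
rewrite addnS; apply: (le_trans (ler_distD (u (n + j)%N) _ _)).
apply: (le_trans (lerD IH (uK (n + j)%N))).
rewrite exprS le_eqVlt; apply/orP; left; apply/eqP.
move: (p0 n) (p0 (n + j)%N) => /lt0r_neq0 + /lt0r_neq0.
by move: (2 ^+ n) (2 ^+ (n + j)) => p q hp hq; field; rewrite hp hq.
Qed.

Section Selections.
Context {R : realType} {E : completeNormedModType R}.
Context {d : measure_display} {T : measurableType d}.
Context (P : probability T R).

Lemma exists_almost_nearest (A : set E) (x : E) (eta : R) : A !=set0 -> 0 < eta ->
  exists2 a, A a & forall a', A a' -> `|x - a| <= `|x - a'| + eta.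
Proof.
move=> [a0 Aa0] eta0; pose S := [set `|x - a| | a in A].
have infS : has_inf S.
  by split; [exists `|x - a0|, a0|exists 0 => _ [a _ <-]].
have [_ [a Aa <-] lt] := inf_adherent eta0 infS.
exists a => // a' Aa'; rewrite (le_trans (ltW lt))// lerD2r.
by apply: ge_inf; [case: infS|exists a'].
Qed.

(** A countably-valued approximation of F at distance less than e everywhere, and
    not only almost everywhere. *)
Definition discretization (F : T -> set E) (e : R) (A : nat -> set E)
    (kappa : T -> nat) : Prop :=
  [/\ forall i, A i !=set0, forall S, measurable (kappa @^-1` S) &
      forall w, (hausdorff_dist (F w) (A (kappa w)) < e%:E)%E].

Context (F : T -> set E) (F_closed : forall w, closed (F w)).
Context (F_discr : forall e, 0 < e -> exists A kappa, discretization F e A kappa).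

Lemma measurable_map_countable_index (f : T -> E) (kappa : nat -> T -> nat)
    (c : nat -> nat -> E) (K : R) :
  (forall n S, measurable (kappa n @^-1` S)) ->
  (forall n w, `|f w - c n (kappa n w)| <= K / 2 ^+ n) -> measurable_map P f.
Proof.
move=> mkappa fc; exists (fun n w => c n (kappa n w)); split.
  move=> n; exists (c n), (fun i => kappa n @^-1` [set i]); split => //.
  - by move=> i j _ _ [w [<- <-]].
  - by apply/seteqP; split => // w _; exists (kappa n w).
  - by move=> i w <-.
have PT : (0 < P setT)%E by rewrite probability_setT.
apply: (@squeeze_cvge _ _ _ _ (fun=> 0%E) _ (fun n => (K / 2 ^+ n)%:E)).
- apply: nearW => n; apply/andP; split.
    by apply: ess_sup_gee => //; apply: aeW => w; rewrite lee_fin.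
  by apply/ess_supP; apply: aeW => w; rewrite lee_fin distrC.
- exact: cvg_cst.
- apply/cvg_EFin; first exact: nearW.
  apply/cvgr0Pnorm_lt => e e0; have [N NP] := geometric_lt K e0.
  exists N => // n /= Nn; rewrite ger0_norm ?NP//.
  exact: le_trans (fc n point).
Qed.

(** Start from g 0 = a (kappa w); then g n.+1 is an almost nearest point to g n in
    an approximation of F of precision e / 2 ^ n.+1. Two consecutive
    approximations are at distance less than e / 2 ^ n + e / 2 ^ n.+1, hence
    the steps are at most 2 e / 2 ^ n, and the limit is in F w because F w is
    closed. No null set is left out, so that the limit is a selection
    everywhere. *)
Lemma exists_selection (A : nat -> set E) (kappa : T -> nat) (e : R) (a : nat -> E) :
  0 < e -> discretization F e A kappa -> (forall i, A i (a i)) ->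
  exists (f : T -> E) (nu : nat -> T -> nat) (c : nat -> nat -> E), [/\
    forall w, F w (f w), forall n S, measurable (nu n @^-1` S),
    forall n w, `|f w - c n (nu n w)| <= (4 * e) / 2 ^+ n &
    forall w, `|f w - a (kappa w)| <= 4 * e].
Proof.
move=> e0 FA Aa.
have p0 n : 0 < 2 ^+ n :> R by rewrite exprn_gt0.
have ep0 n : 0 < e / 2 ^+ n by rewrite divr_gt0.
have /choice[Ak AkP] : forall n, exists Ak : (nat -> set E) * (T -> nat),
    discretization F (e / 2 ^+ n) Ak.1 Ak.2 /\ (n = 0%N -> Ak = (A, kappa)).
  case=> [|n]; first by exists (A, kappa); rewrite expr0 divr1.
  by have [A' [k' H]] := F_discr (ep0 n.+1); exists (A', k').
have Ak0 := (AkP 0%N).2 erefl.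
have /choice[pt ptP] : forall nix : nat * nat * E, exists y,
    (Ak nix.1.1).1 nix.1.2 y /\ forall y', (Ak nix.1.1).1 nix.1.2 y' ->
      `|nix.2 - y| <= `|nix.2 - y'| + e / 2 ^+ nix.1.1.
  move=> [[n i] x] /=; have [[A0 _ _] _] := AkP n.
  by have [y Ay yP] := exists_almost_nearest x (A0 i) (ep0 n); exists y.
pose g := fix g n w := if n is n'.+1 then pt (n, (Ak n).2 w, g n' w) else a (kappa w).
(* g n depends on w through the indices of the approximations 0 to n only; nu n
   encodes them in one natural number, which c n decodes. *)
pose nu := fix nu n w := if n is n'.+1 then choice.pickle (nu n' w, (Ak n).2 w) else kappa w.
pose c := fix c n k := if n is n'.+1 then
   (if choice.unpickle k is Some ij then pt (n, ij.2, c n' ij.1) else 0) else a k.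
have gc n w : g n w = c n (nu n w).
  by elim: n => //= n IH; rewrite choice.pickleK IH.
have mnu n S : measurable (nu n @^-1` S).
  elim: n S => [|n IH] S /=; first by case: FA.
  have [[_ mk _] _] := AkP n.+1.
  rewrite (_ : _ @^-1` _ = \bigcup_i (nu n @^-1` [set i] `&`
      (Ak n.+1).2 @^-1` [set j | S (choice.pickle (i, j))])).
    by apply: bigcup_measurable => i _; apply: measurableI.
  apply/seteqP; split => [w Sw|w [i _ [/= <-]]//].
  by exists (nu n w).
have gA n w : (Ak n).1 ((Ak n).2 w) (g n w).
  case: n => [|n] /=; first by rewrite Ak0; exact: Aa.
  exact: (ptP (n.+1, (Ak n.+1).2 w, g n w)).1.
have gF n w : exists2 y, F w y & `|g n w - y| < e / 2 ^+ n.
  have [[_ _ h] _] := AkP n; apply: hausdorff_dist_lt (gA n w).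
  by rewrite hausdorff_dist_sym.
have gstep n w : `|g n w - g n.+1 w| <= (2 * e) / 2 ^+ n.
  have [y Fy gy] := gF n w; have [[_ _ h] _] := AkP n.+1.
  have [a' Aa' ya'] := hausdorff_dist_lt (h w) Fy.
  have := (ptP (n.+1, (Ak n.+1).2 w, g n w)).2 _ Aa' => /= /le_trans; apply.
  have := ler_distD y (g n w) a'.
  move: gy ya'; rewrite exprS invfM -!mulrA; move: (2 ^+ n)^-1 => r; lra.
have /choice[f fP] : forall w, exists l, forall n, `|g n w - l| <= (2 * (2 * e)) / 2 ^+ n.
  move=> w; have [l _ lP] := geometric_cauchy_cvg (geometric_steps (gstep^~ w)).
  by exists l.
have fg n w : `|f w - g n w| <= (4 * e) / 2 ^+ n.
  by rewrite distrC (le_trans (fP w n))// mulrA -natrM.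
exists f, nu, c; split => //.
- move=> w; apply: (@F_closed w); apply/closureP => eta eta0.
  have [n nP] := geometric_lt (5 * e) eta0.
  have [y Fy gy] := gF n w; exists y => //.
  have := nP n (leqnn n); have := fg n w; have := ler_distD (g n w) (f w) y.
  by move: gy; rewrite -!mulrA; lra.
- by move=> n w; rewrite -gc.
- by move=> w; have := fg 0%N w; rewrite expr0 divr1.
Qed.

End Selections.

(** * The expectation against weighted sums of hulls *)
Section ExpectationApproximation.
Context {R : realType} {E : completeNormedModType R}.
Context {d : measure_display} {T : measurableType d}.
Context (P : probability T R).
Context (F : T -> set E) (F_closed : forall w, closed (F w)).
Context (F_discr : forall e, 0 < e -> exists A kappa, discretization F e A kappa).
Context (A : nat -> set E) (kappa : T -> nat) (e : R).
Context (e_gt0 : 0 < e) (FA : discretization F e A kappa).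
Context (alpha : nat -> R) (m : nat) (tau : R).
Context (alpha_ge0 : forall i, 0 <= alpha i).
Context (A_le : forall i x, A i x -> `|x| <= alpha i).
Context (alpha_fin : (\int[P]_w (alpha (kappa w))%:E < +oo)%E).
Context (alpha_tail :
  (\int[P]_w (alpha (kappa w) * (m <= kappa w)%N%:R)%:E <= tau%:E)%E).

Let p i := fine (P (kappa @^-1` [set i])).

Let mkappa S : measurable (kappa @^-1` S).
Proof. by case: FA. Qed.

(** The index cut off at m: the value m gathers all the indices from m on, which
    makes the index finite. *)
Let level w : 'I_m.+1 := inord (minn (kappa w) m).

Let mlevel j : measurable (level @^-1` [set j]).
Proof. exact: (mkappa [set k | inord (minn k m) = j :> 'I_m.+1]). Qed.

Let levelE w : (level w < m)%N = (kappa w < m)%N.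
Proof. by rewrite /level inordK ?ltnS ?geq_minr// gtn_min ltnn orbF. Qed.

Let level_val w : (kappa w < m)%N -> level w = kappa w :> nat.
Proof. by move=> km; rewrite /level inordK ?ltnS ?geq_minr// (minn_idPl (ltnW km)). Qed.

Let level_preimage (i : 'I_m) :
  level @^-1` [set widen_ord (leqnSn m) i] = kappa @^-1` [set val i].
Proof.
apply/seteqP; split => w /=.
  by move=> li; rewrite -level_val -?levelE li //=.
move=> ki; have km : (kappa w < m)%N by rewrite ki.
by apply/val_inj; rewrite /= level_val.
Qed.

Let mtail (c : R) : measurable_fun setT
  (fun w => c + alpha (kappa w) * (m <= kappa w)%N%:R).
Proof. exact: (measurable_fun_index (fun k => c + alpha k * (m <= k)%N%:R)). Qed.

Let tail_integral (c : R) : 0 <= c ->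
  (\int[P]_w (c + alpha (kappa w) * (m <= kappa w)%N%:R)%:E <= (c + tau)%:E)%E.
Proof.
move=> c0; under eq_integral do rewrite EFinD.
rewrite ge0_integralD//; last 2 first.
- by move=> w _; rewrite lee_fin mulr_ge0.
- apply/measurable_EFinP.
  exact: (measurable_fun_index (fun k => alpha k * (m <= k)%N%:R)).
rewrite integral_probability_cst.
by rewrite EFinD leeD2l.
Qed.

Let F_norm_le w x : F w x -> `|x| <= alpha (kappa w) + e.
Proof.
have [_ _ h] := FA; move=> /(hausdorff_dist_lt (h w))[y Ay xy].
have := ler_normD (x - y) y; rewrite subrK => /le_trans; apply.
by rewrite addrC lerD// ?A_le// ltW.
Qed.

(** Let s be a simple map close to f in mean. On the event kappa = i with i < m,
    each value of s is moved to an almost nearest point of A i; elsewhere it is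
    replaced by 0. The resulting simple map t differs from s by hardly more than
    |f - s| + e, plus the norm of the tail, and on each event kappa = i its
    values average to a point of the hull of A i. *)
Lemma selection_integral_near_hulls (f : T -> E) (I : E) :
  (forall w, F w (f w)) -> bochner_integral P f I ->
  thickening (e + tau) (weighted_hull_sum A p m) I.
Proof.
move=> Ff [s [simple_s _ sf sI]] eta eta0.
have eta30 : 0 < eta / 3 by rewrite divr_gt0.
have [N1 _ N1P] := sf _ (@nbhs_open_ereal_lt R 0 (fun=> eta / 3) eta30).
have /cvgrPdist_le/(_ _ eta30)[N2 _ N2P] := sI.
pose n := maxn N1 N2.
have {N2P}Is : `|I - simple_integral P (s n)| <= eta / 3 by exact: N2P (leq_maxr _ _).
have {N1P}fs := N1P n (leq_maxl _ _).
have [J [k [c [mk sE]]]] := simple_map_factor (simple_s n).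
have A0 i : A i !=set0 by case: FA.
have /choice[a aP] : forall ji : J * nat, exists y, A ji.2 y /\
    forall y', A ji.2 y' -> `|c ji.1 - y| <= `|c ji.1 - y'| + eta / 3.
  move=> [j i] /=; have [y Ay yP] := exists_almost_nearest (c j) (A0 i) eta30.
  by exists y.
have mkl := measurable_pair_finite_index mk mlevel.
pose c' (j : J * 'I_m.+1) : E := if (j.2 < m)%N then a (j.1, val j.2) else 0.
pose t := c' \o (fun w => (k w, level w)).
have simple_t : simple_map t := simple_map_finite_index mkl c'.
pose w_ j := fine (P ((fun w => (k w, level w)) @^-1` [set j])).
have w0 j : 0 <= w_ j by rewrite fine_ge0.
have st : `|simple_integral P (s n) - simple_integral P t| <= e + 2 * (eta / 3) + tau.
  rewrite -lee_fin (le_trans (simple_integral_dist P (simple_s n) simple_t))//.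
  rewrite (_ : e + _ + _ = eta / 3 + (e + eta / 3 + tau)); last by ring.
  rewrite [leRHS]EFinD.
  apply: (@le_trans _ _ _ _ _ _ (leeD (ltW fs) (tail_integral _))); last first.
    by rewrite addr_ge0// ltW.
  have eeta0 : 0 <= e + eta / 3 by rewrite addr_ge0// ltW.
  apply: integral_le_add => //.
  - exact: simple_map_normB.
  - by move=> w; rewrite addr_ge0// mulr_ge0.
  move=> w; rewrite sE /t /c' /=; rewrite levelE.
  case: ltnP => km; last first.
    rewrite subr0 mulr1.
    have := F_norm_le (Ff w); have := ler_normD (f w) (c (k w) - f w).
    by rewrite addrC subrK (distrC (f w)); lra.
  rewrite level_val// mulr0 addr0.
  have [_ _ h] := FA; have [y Ay fy] := hausdorff_dist_lt (h w) (Ff w).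
  have := (aP (k w, kappa w)).2 y Ay => /=.
  have := ler_distD (f w) (c (k w)) y.
  by rewrite (distrC (c (k w)) (f w)); lra.
suff [z Dz zt] : exists2 z, weighted_hull_sum A p m z & simple_integral P t = z.
  exists z => //; rewrite -zt.
  by have := ler_distD (simple_integral P (s n)) I (simple_integral P t); lra.
have /choice[b bP] : forall i : nat, exists b, (i < m)%N ->
    closed_convex_hull (A i) b /\
    \sum_(j | val j.2 == i) w_ j *: c' j = p i *: b.
  move=> i; have [im|_] := ltnP i m; last by exists 0.
  have [|||j /eqP ji|b Ab bE] := @convex_weighted_sum R E _ (index_enum _)
      (fun j : J * 'I_m.+1 => val j.2 == i) w_ c' (closed_convex_hull (A i)).
  - exact: convex_closed_convex_hull.
  - by have [y Ay] := A0 i; exists y; exact: sub_closed_convex_hull.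
  - by move=> *.
  - have jm : (j.2 < m)%N by rewrite -[nat_of_ord _]/(val j.2) ji.
    rewrite /c' jm ji; apply: sub_closed_convex_hull.
    exact: (aP (j.1, i)).1.
  exists b => _; split => //; rewrite bE; congr (_ *: _).
  rewrite /p -[i]/(val (Ordinal im)) -level_preimage.
  rewrite (_ : level @^-1` _ = (fun w => (k w, level w)) @^-1` [set j | val j.2 = i]).
    rewrite (probability_finite_index P mkl); apply: eq_bigl => j.
    by apply/eqP/idP; rewrite inE.
  apply/seteqP; split => w /=; first by move=> ->.
  by move=> li; apply/val_inj.
exists (\sum_(i < m) p i *: b i).
  by exists b => // i im; have [] := bP i im.
rewrite (simple_integral_finite_index P mkl).
rewrite (partition_big (fun j : J * 'I_m.+1 => j.2) xpredT)//= big_ord_recr/=.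
rewrite [X in _ + X]big1 ?addr0; last first.
  by move=> j /eqP jm; rewrite /c' jm /= ltnn scaler0.
apply: eq_bigr => i _; have [_ <-] := bP i (ltn_ord i).
by apply: eq_bigl => j; rewrite -val_eqE.
Qed.

(** The selection given by [exists_selection] differs from a (kappa w) by at most
    4 e, and from 0 by at most alpha (kappa w) + e where kappa w >= m. *)
Lemma weighted_sum_near_expectation (a : nat -> E) :
  (forall i, (i < m)%N -> A i (a i)) ->
  thickening (4 * e + tau) (aumann_expectation P F) (\sum_(i < m) p i *: a i).
Proof.
move=> Aa.
have A0 i : A i !=set0 by case: FA.
have /choice[a' Aa'] : forall i, exists y, A i y /\ ((i < m)%N -> y = a i).
  move=> i; have [im|_] := ltnP i m; first by exists (a i); split => //; exact: Aa.
  by have [y Ay] := A0 i; exists y.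
have [f [nu [c [Ff mnu fc fa]]]] :=
  exists_selection F_closed F_discr e_gt0 FA (fun i => (Aa' i).1).
have mbeta : measurable_fun setT (fun w => alpha (kappa w) + e).
  exact: (measurable_fun_index (fun k => alpha k + e)).
have beta_fin : (\int[P]_w (alpha (kappa w) + e)%:E < +oo)%E.
  under eq_integral do rewrite EFinD.
  rewrite ge0_integralD//; last 3 first.
  + by move=> w _; rewrite lee_fin.
  + by apply/measurable_EFinP; exact: measurable_fun_index.
  + by move=> w _; rewrite lee_fin ltW.
  by rewrite integral_probability_cst lte_add_pinfty// ltry.
have [I fI] := bochner_integrable mnu fc mbeta (fun w => F_norm_le (Ff w)) beta_fin.
move=> eta eta0; exists I.
  apply: subset_closure; exists f => //; split => //.
  exact: measurable_map_countable_index mnu fc.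
pose c' (j : 'I_m.+1) := if (j < m)%N then a j else 0.
pose t := c' \o level.
have <- : simple_integral P t = \sum_(i < m) p i *: a i.
  rewrite /t (simple_integral_finite_index P mlevel) big_ord_recr/=.
  rewrite {2}/c' /= ltnn scaler0 addr0; apply: eq_bigr => i _.
  by rewrite level_preimage /c' /= ltn_ord.
rewrite distrC (@le_trans _ _ (4 * e + tau))//; last by rewrite lerDl ltW.
apply: (bochner_integral_dist fI (simple_map_finite_index mlevel c') (mtail (4 * e))).
- by move=> w; rewrite addr_ge0 ?mulr_ge0// ltW.
- move=> w; rewrite /c' /= levelE; case: ltnP => km.
    rewrite level_val// mulr0 addr0 -(Aa' (kappa w)).2//.
  rewrite subr0 mulr1 (le_trans (F_norm_le (Ff w)))// addrC lerD2r.
  by rewrite ler_peMl ?ltW// ltr1n.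
- by apply: tail_integral; rewrite mulr_ge0// ltW.
Qed.

Lemma expectation_near_hulls :
  aumann_expectation P F `<=` thickening (e + tau) (weighted_hull_sum A p m).
Proof.
move=> x Fx; apply: closed_thickening; apply: closureS Fx => I [f [_ Ff] fI].
exact: selection_integral_near_hulls fI.
Qed.

Lemma hulls_near_expectation : convex_set (aumann_expectation P F) ->
  weighted_hull_sum A p m `<=` thickening (4 * e + tau) (aumann_expectation P F).
Proof.
move=> cF; apply: weighted_hull_sum_thickening => //.
- by move=> i; rewrite /p fine_ge0.
- exact: weighted_sum_near_expectation.
Qed.

End ExpectationApproximation.

(** * The strong law for random sets *)
Lemma cvge0_le {R : realType} (u : nat -> \bar R) : (forall n, 0 <= u n)%E ->
  (forall e : R, 0 < e -> \forall n \near \oo, (u n <= e%:E)%E) ->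
  u n @[n --> \oo] --> 0%E.
Proof.
move=> u0 ue; apply/fine_cvgP; split.
  by apply: filterS (ue 1 ltr01) => n un; rewrite ge0_fin_numE// (le_lt_trans un)// ltry.
apply/cvgrPdist_le => e e0; apply: filterS (ue e e0) => n un /=.
rewrite sub0r normrN ger0_norm ?fine_ge0// -lee_fin fineK//.
by rewrite ge0_fin_numE// (le_lt_trans un)// ltry.
Qed.

Section SetNorm.
Context {R : realType} {E : completeNormedModType R}.
Implicit Types A B : set E.

Lemma set_norm_ge0 A : A !=set0 -> (0 <= set_norm A)%E.
Proof.
by move=> [x Ax]; apply: le_ereal_sup_tmp; exists (`|x|)%:E; [exists x|rewrite lee_fin].
Qed.

Lemma set_norm_fin_num A : nonempty_closed_bounded A -> set_norm A \is a fin_num.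
Proof.
move=> [A0 _ [M [_ MA]]]; rewrite ge0_fin_numE ?set_norm_ge0//.
apply: (@le_lt_trans _ _ (M + 1)%:E); last by rewrite ltry.
apply: ge_ereal_sup => _ [x Ax <-]; rewrite lee_fin.
by apply: (MA (M + 1)) => //; rewrite ltrDl.
Qed.

Lemma norm_le_set_norm A x : nonempty_closed_bounded A -> A x ->
  `|x| <= fine (set_norm A).
Proof.
move=> bA Ax; rewrite -lee_fin fineK ?set_norm_fin_num//.
by apply: ereal_sup_ubound; exists x.
Qed.

Lemma set_norm_hausdorff_le A B (e : R) :
  nonempty_closed_bounded A -> nonempty_closed_bounded B ->
  (hausdorff_dist A B < e%:E)%E -> fine (set_norm B) <= fine (set_norm A) + e.
Proof.
move=> bA bB; rewrite hausdorff_dist_sym => BA.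
rewrite -lee_fin fineK ?set_norm_fin_num//; apply: ge_ereal_sup => _ [x Bx <-].
have [y Ay xy] := hausdorff_dist_lt BA Bx; rewrite lee_fin.
have := ler_normD (x - y) y; rewrite subrK => /le_trans; apply.
by rewrite addrC lerD ?norm_le_set_norm// ltW.
Qed.

End SetNorm.

Section SetValuedStrongLaw.
Context {R : realType} {E : completeNormedModType R}.
Context {d : measure_display} {T : measurableType d}.
Context (P : probability T R) (P_complete : measure_is_complete P).
Context (U : set (set E)) (U_nonempty : U !=set0).
Context (U_closed_bounded : U `<=` nonempty_closed_bounded).
Context (U_separable : hausdorff_separable U).
Context (X : nat -> T -> set E).
Context (X_random : forall n, random_set P (X n)).
Context (X_in_U : forall n w, U (X n w)).
Context (X_indep : independent_random_sets P U X).
Context (X_ident : identically_distributed_random_sets P U X).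

Lemma measurable_random_set_preimage (n : nat) (B : set (set E)) :
  hausdorff_borel U B -> measurable (X n @^-1` B).
Proof.
have [mX _] := X_random n.
exact: (measurable_hausdorff_borel P_complete U_nonempty U_separable mX (X_in_U n)).
Qed.

(** Independence of all finite subfamilies, read on the subfamily of j and k. *)
Lemma independent_random_sets2 (j k : nat) (B C : set (set E)) : j != k ->
  hausdorff_borel U B -> hausdorff_borel U C ->
  (P (X j @^-1` B `&` X k @^-1` C) = P (X j @^-1` B) * P (X k @^-1` C))%E.
Proof.
move=> jk bB bC.
pose V l := if l == j then B else C.
have kj : (k == j) = false by rewrite eq_sym; apply/negbTE.
have VP l : l \in [fset j; k]%fset -> hausdorff_borel U (V l).
  by move=> _; rewrite /V; case: ifP.
have := X_indep VP.
rewrite big_fsetU1 ?inE//= big_seq_fset1 /V eqxx kj => <-; congr (P _).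
apply/seteqP; split => w /=.
  by move=> [Bw Cw] l /=; rewrite !inE => /orP[/eqP ->|/eqP ->]; rewrite ?eqxx ?kj.
move=> H; split.
  by have := H j; rewrite /= !inE eqxx /=; apply.
by have := H k; rewrite /= !inE eqxx orbT kj /=; apply.
Qed.

Context (A : nat -> set E) (idx : set E -> nat) (e : R).
Context (A_in_U : forall i, U (A i)).
Context (A_near : forall Y, U Y -> (hausdorff_dist Y (A (idx Y)) < e%:E)%E).
Context (idx_borel : forall S : set nat, hausdorff_borel U [set Y | U Y /\ S (idx Y)]).

Let iota k w := idx (X k w).

Let iota_preimage k (S : set nat) :
  iota k @^-1` S = X k @^-1` [set Y | U Y /\ S (idx Y)].
Proof. by apply/seteqP; split => w /=; [move=> Sw; split|case]. Qed.

Let measurable_iota k (S : set nat) : measurable (iota k @^-1` S).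
Proof. by rewrite iota_preimage; exact: measurable_random_set_preimage. Qed.

Let measurable_phi (phi : nat -> R) k : measurable_fun setT (fun w => phi (iota k w)).
Proof. exact: measurable_fun_index. Qed.

Let independent_phi (phi : nat -> R) j k : j != k ->
  independent P (fun w => phi (iota j w)) (fun w => phi (iota k w)).
Proof.
move=> jk B C _ _.
have := @independent_random_sets2 j k _ _ jk (idx_borel [set i | B (phi i)])
  (idx_borel [set i | C (phi i)]).
by rewrite -!iota_preimage.
Qed.

Let same_law_phi (phi : nat -> R) k :
  same_law P (fun w => phi (iota k w)) (fun w => phi (iota 0%N w)).
Proof.
move=> B _; have := X_ident k 0%N (idx_borel [set i | B (phi i)]).
by rewrite -!iota_preimage.
Qed.

Lemma discretization_cells : discretization (X 0%N) e A (iota 0%N).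
Proof.
split => [i|S|w]; first by have [] := U_closed_bounded (A_in_U i).
- exact: measurable_iota.
- exact: A_near.
Qed.

Let alpha i := fine (set_norm (A i)).

Let alpha_ge0 i : 0 <= alpha i.
Proof. by rewrite fine_ge0// set_norm_ge0//; have [] := U_closed_bounded (A_in_U i). Qed.

Let A_le i x : A i x -> `|x| <= alpha i.
Proof. by apply: norm_le_set_norm; exact: U_closed_bounded. Qed.

(** The norms of two sets differ by at most their Hausdorff distance, and the norm
    of X 0 is integrable. *)
Lemma integral_cell_norm_fin : 0 < e -> (\int[P]_w (alpha (iota 0%N w))%:E < +oo)%E.
Proof.
move=> e0; have [_ X_fin] := X_random 0%N.
have bX w : nonempty_closed_bounded (X 0%N w) by exact: U_closed_bounded.
apply: (@le_lt_trans _ _ (\int[P]_w (fine (set_norm (X 0%N w)))%:E + \int[P]_w e%:E)%E).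
  apply: (@integral_le_add _ _ _ P (fun w => alpha (iota 0%N w)) (fun=> e)
    (fun w => fine (set_norm (X 0%N w)))) => //.
  - by move=> w; rewrite ltW.
  - by move=> w; rewrite fine_ge0// set_norm_ge0//; case: (bX w).
  - move=> w; apply: set_norm_hausdorff_le => //; first exact: U_closed_bounded.
    exact: A_near.
under eq_integral do rewrite fineK ?set_norm_fin_num//.
by rewrite integral_probability_cst lte_add_pinfty// ltry.
Qed.

(** The frequency errors are controlled by [bounded_strong_law] applied to the
    indicators of the events iota k = i, with a precision delta such that the
    m weighted errors add up to at most e; the share of the large indices is
    at most 2 * (e + e) by [dyadic_strong_law], as its mean is at most e. *)
Lemma ae_discrepancy_le (m : nat) : 0 < e ->
  (\int[P]_w (alpha (iota 0%N w) * (m <= iota 0%N w)%N%:R)%:E <= e%:E)%E ->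
  {ae P, forall w, \forall n \near \oo,
    discrepancy alpha (fun i => fine (P (iota 0%N @^-1` [set i]))) m n
      (fun k => iota k w) <= 5 * e}.
Proof.
move=> e0 tail; set p := fun i => fine _.
pose delta := e / (1 + \sum_(i < m) alpha i).
have sum0 : 0 <= \sum_(i < m) alpha i by apply: sumr_ge0.
have delta0 : 0 < delta by rewrite divr_gt0// ltr_pwDl.
pose theta i := alpha i * (m <= i)%N%:R.
have theta0 i : 0 <= theta i by rewrite mulr_ge0.
have tail_fin : (\int[P]_w (theta (iota 0%N w))%:E)%E \is a fin_num.
  rewrite ge0_fin_numE; first by rewrite (le_lt_trans tail)// ltry.
  by apply: integral_ge0 => w _; rewrite lee_fin.
have tail_ae := @dyadic_strong_law _ _ _ P (fun k w => theta (iota k w))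
  (measurable_phi theta) (fun k w => theta0 _)
  (fun j k jk => independent_phi theta jk) (same_law_phi theta)
  _ e (esym (fineK tail_fin)) e0.
have freq_ae : {ae P, forall w, forall i, \forall n \near \oo,
    `|\sum_(k < n) (iota k w == i)%:R - n%:R * p i| <= n%:R * delta}.
  apply: ae_foralln => i.
  have phi0 k : 0 <= (k == i)%:R :> R by [].
  have phi1 k : (k == i)%:R <= 1 :> R by case: (_ == _).
  have := @bounded_strong_law _ _ _ P (fun k w => (iota k w == i)%:R)
    (measurable_phi (fun k => (k == i)%:R)) (fun k w => phi0 _)
    (fun j k jk => independent_phi (fun k => (k == i)%:R) jk)
    (same_law_phi (fun k => (k == i)%:R)) delta (fun k w => phi1 _) delta0.
  suff -> : fine (\int[P]_w ((iota 0%N w == i)%:R)%:E) = p i by [].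
  rewrite /p; congr fine.
  transitivity (\int[P]_w (\1_(iota 0%N @^-1` [set i]) w)%:E)%E; last first.
    by rewrite integral_indic// setIT.
  apply: eq_integral => w _; rewrite indicE.
  by case: eqP => wi; [rewrite mem_set|rewrite memNset].
apply: filterS2 tail_ae freq_ae => w tail_w freq_w.
have freq_all : \forall n \near \oo, forall i : 'I_m,
    `|\sum_(k < n) (iota k w == i)%:R - n%:R * p i| <= n%:R * delta.
  by apply: filter_forall => i; exact: freq_w.
have [N _ NP] : \forall n \near \oo,
    \sum_(k < n) theta (iota k w) <=
      2 * n%:R * (fine (\int[P]_w (theta (iota 0%N w))%:E)%E + e) /\
    forall i : 'I_m, `|\sum_(k < n) (iota k w == i)%:R - n%:R * p i| <= n%:R * delta.
  exact: filterI.
exists N => // n /= Nn.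
have [theta_le freq_le] := NP n.+1 (leqW Nn).
have n0 : 0 < n.+1%:R :> R by [].
have -> : 5 * e = e + 4 * e by ring.
rewrite /discrepancy lerD//.
  apply: (@le_trans _ _ (\sum_(i < m) delta * alpha i)).
    apply: ler_sum => i _; rewrite ler_wpM2r//.
    rewrite -(ler_pM2l n0) -[X in X * `|_| <= _](ger0_norm (ltW n0)) -normrM.
    by rewrite mulrBr mulrCA divff ?mulr1 ?lt0r_neq0.
  rewrite -mulr_sumr /delta mulrAC ler_pdivrMr ?ltr_pwDl//.
  by rewrite ler_wpM2l ?(ltW e0)// lerDr.
rewrite ler_pdivrMr//.
have theta_fine : fine (\int[P]_w (theta (iota 0%N w))%:E)%E <= e.
  by rewrite -lee_fin fineK.
under eq_bigr do rewrite mulrC.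
rewrite (le_trans theta_le)//.
have -> : 4 * e * n.+1%:R = 2 * n.+1%:R * (e + e) by ring.
by rewrite ler_wpM2l ?mulr_ge0// lerD2r.
Qed.

End SetValuedStrongLaw.

(* The random set X_{n+1} of the sequence {X_n}_{n >= 1} is X n. *)
Theorem theorem6p1 (R : realType) (E : completeNormedModType R)
    (d : measure_display) (T : measurableType d) (P : probability T R)
    (P_complete : measure_is_complete P) (P_without_atoms : without_atoms P)
    (U : set (set E)) (U_nonempty : U !=set0)
    (U_closed_bounded : U `<=` nonempty_closed_bounded)
    (U_separable : hausdorff_separable U)
    (X : nat -> T -> set E)
    (X_random : forall n, random_set P (X n))
    (X_in_U : forall n w, U (X n w))
    (X_indep : independent_random_sets P U X)
    (X_ident : identically_distributed_random_sets P U X)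
    (C : set E) (C_closed_convex : nonempty_closed_convex_bounded C)
    (X_expectation : forall n, aumann_expectation P (X n) = C) :
  {ae P, forall w,
    hausdorff_dist
      (set_scale (n.+1%:R^-1)
         (closure (minkowski_sum
            (fun i : 'I_n.+1 => closed_convex_hull (X i w)))))
      C @[n --> \oo] --> 0%E}.
Proof.
have F_closed w : closed (X 0%N w) by have [] := U_closed_bounded _ (X_in_U 0%N w).
have F_discr e : 0 < e -> exists A kappa, discretization (X 0%N) e A kappa.
  move=> e0; have [A [idx [AU Anear idxB]]] := borel_cells U_nonempty U_separable e0.
  exists A, (fun w => idx (X 0%N w)).
  exact: (discretization_cells P_complete U_nonempty U_closed_bounded U_separable
    X_random X_in_U AU Anear idxB).
have [[C_neq0 _ _] C_convex] := C_closed_convex.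
pose S n w := set_scale (n.+1%:R^-1) (closure (minkowski_sum
  (fun i : 'I_n.+1 => closed_convex_hull (X i w)))).
(* The constant 11 is (1 + 5) + (4 + 1): average to D, then D to C. *)
have S_near e : 0 < e -> {ae P, forall w, \forall n \near \oo,
    (hausdorff_dist (S n w) C <= (11 * e)%:E)%E}.
  move=> e0; have [A [idx [AU Anear idxB]]] := borel_cells U_nonempty U_separable e0.
  pose iota k w := idx (X k w); pose alpha i := fine (set_norm (A i)).
  have XA : discretization (X 0%N) e A (iota 0%N).
    exact: (discretization_cells P_complete U_nonempty U_closed_bounded U_separable
      X_random X_in_U AU Anear idxB).
  have A_neq0 i : A i !=set0 by have [] := U_closed_bounded _ (AU i).
  have A_le i x : A i x -> `|x| <= alpha i.
    by apply: norm_le_set_norm; exact: U_closed_bounded.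
  have alpha0 i : 0 <= alpha i by rewrite fine_ge0// set_norm_ge0.
  have alpha_fin : (\int[P]_w (alpha (iota 0%N w))%:E < +oo)%E.
    exact: (integral_cell_norm_fin P_complete U_nonempty U_closed_bounded U_separable
      X_random X_in_U AU Anear idxB e0).
  have [_ miota _] := XA.
  have [m tail] : exists m,
      (\int[P]_w (alpha (iota 0%N w) * (m <= iota 0%N w)%N%:R)%:E <= e%:E)%E.
    apply: integral_tail_le => //.
    exact: measurable_fun_index.
  pose p i := fine (P (iota 0%N @^-1` [set i])).
  have p0 i : 0 <= p i by rewrite fine_ge0.
  have CD : C `<=` thickening (e + e) (weighted_hull_sum A p m).
    rewrite -(X_expectation 0%N).
    exact: (expectation_near_hulls e0 XA alpha0 A_le tail).
  have DC : weighted_hull_sum A p m `<=` thickening (4 * e + e) C.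
    rewrite -(X_expectation 0%N); apply: (hulls_near_expectation F_closed F_discr e0
      XA alpha0 A_le alpha_fin tail).
    by rewrite X_expectation.
  have := ae_discrepancy_le P_complete U_nonempty U_closed_bounded U_separable
    X_random X_in_U X_indep X_ident AU idxB e0 tail.
  apply: filterS => w; apply: filterS => n disc.
  have XAw k : X k w `<=` thickening e (A (iota k w)).
    by apply: hausdorff_dist_thickening; exact: Anear.
  have AXw k : A (iota k w) `<=` thickening e (X k w).
    apply: hausdorff_dist_thickening; rewrite hausdorff_dist_sym; exact: Anear.
  pose rho := discrepancy alpha p m n (fun k => iota k w).
  have SD : S n w `<=` thickening (e + rho) (weighted_hull_sum A p m).
    by apply: (@average_sub_weighted_hull_sum _ _ A alpha p m A_neq0 A_le n _
      (fun k => X k w)) => // k _; exact: XAw.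
  have DS : weighted_hull_sum A p m `<=` thickening (e + rho) (S n w).
    by apply: (@weighted_hull_sum_sub_average _ _ A alpha p m A_neq0 A_le n _
      (fun k => X k w)) => // k _; exact: AXw.
  have {}disc : rho <= 5 * e by [].
  apply: hausdorff_dist_le.
    apply: subset_trans (thickening_triangle SD DC) _.
    by apply: thickening_le; lra.
  apply: subset_trans (thickening_triangle CD DS) _.
  by apply: thickening_le; lra.
have S_near' : {ae P, forall w, forall k, \forall n \near \oo,
    (hausdorff_dist (S n w) C <= (11 * k.+1%:R^-1)%:E)%E}.
  by apply: ae_foralln => k; apply: S_near; rewrite invr_gt0.
apply: filterS S_near' => w Sw; apply: cvge0_le => [n|e e0].
  by rewrite hausdorff_dist_sym; exact: hausdorff_dist_ge0.
have e110 : 0 < e / 11 by rewrite divr_gt0.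
have [k] := ltr_add_invr e110; rewrite add0r => ke.
apply: filterS (Sw k) => n /le_trans; apply.
by rewrite lee_fin; move: (_^-1) ke => x ke; lra.
Qed.
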